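(* Fix $L>0$, $\sigma_-<0<\sigma_+$, put $\kappa:=\sigma_+/\sigma_-<0$, and fix mesh ratios $r>0$, $r_y>0$. Consider admissible meshes, i.e. $h_-=L/N_-$, $h_+=L/N_+$, $h_y=\pi/M$ with $N_-,N_+,M\in\mathbb N$, $h_+=rh_-$, $h_y=r_yh_-$, and the discrete operator $\tilde{\mathcal A}_{h_\pm,h_y}$ on $\tilde V_{h_\pm}\otimes W_{h_y}$ defined in the context. (i) If for some $\epsilon\in(0,1)$ either ($|\kappa|(1+\epsilon)<1$ and $r^2\kappa^2(1+\epsilon)^2<1+r_y^2(1-\kappa^2(1+\epsilon)^2)$) or ($|\kappa|(1-\epsilon)>1$ and $r^2\kappa^2(1-\epsilon)^2>1+r_y^2(1-\kappa^2(1-\epsilon)^2)$), then there exists $\delta>0$ such that for all admissible meshes with $h_-\in(0,\delta)$ the inverse $\tilde{\mathcal A}_{h_\pm,h_y}^{-1}$ exists and $$\|\tilde{\mathcal A}_{h_\pm,h_y}^{-1}\|\le\frac{1}{|\sigma_-|\min_{p\in\{\pm1\}}\min\left\{1,|\kappa|,\frac{|1+(1+p\epsilon)\kappa|}{2+\epsilon},\frac{\left|\sqrt{1+r_y^2}+(1+p\epsilon)\kappa\sqrt{r^2+r_y^2}\right|}{\sqrt{1+r_y^2}+(1+\epsilon)\sqrt{r^2+r_y^2}}\right\}}.$$ (ii) Contrary, if either ($|\kappa|<1$ and $r^2\kappa^2>1+r_y^2(1-\kappa^2)$) or ($|\kappa|>1$ and $r^2\kappa^2<1+r_y^2(1-\kappa^2)$),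 then $$\lim_{h_-\to0}\|\tilde{\mathcal A}_{h_\pm,h_y}^{-1}\|=+\infty,$$ where the limit is taken along admissible meshes with fixed $r,r_y$ (i.e. for every $C>0$ there is $\eta>0$ such that $\|\tilde{\mathcal A}_{h_\pm,h_y}^{-1}\|\ge C$ for every admissible mesh with $h_-<\eta$).
   Context: $\mathbb N=\{1,2,\dots\}$; all spaces are real. $\tilde\Omega=(-L,L)\times(0,\pi)$. The coefficient $\sigma$ equals the constant $\sigma_-<0$ for $x<0$ and the constant $\sigma_+>0$ for $x>0$. $H^1_0(\tilde\Omega)$ and its subspaces carry the scalar product $\langle u,v\rangle_{H^1_0(\tilde\Omega)}=\int_{\tilde\Omega}\nabla u\cdot\nabla v$. Put $a_{\tilde\Omega}(u,v)=\int_{\tilde\Omega}\sigma\nabla u\cdot\nabla v$. Discrete spaces: $W_{h_y}$ is the space of $w\in H^1_0(0,\pi)$ that are affine on each interval $(h_ym,h_y(m+1))$, $m=0,\dots,M-1$. With $\tilde x_n=h_+n$ for $n=0,\dots,N_+$ and $\tilde x_n=h_-n$ for $n=-1,\dots,-N_-$, $\tilde V_{h_\pm}$ is the space of $v\in H^1_0(-L,L)$ that are affine on each $(\tilde x_n,\tilde x_{n+1})$, $n=-N_-,\dots,N_+-1$. $\tilde V_{h_\pm}\otimes W_{h_y}\subset H^1_0(\tilde\Omega)$ is the span of the functions $(x,y)\mapsto v(x)w(y)$. The operator $\tilde{\mathcal A}_{h_\pm,h_y}$ on $\tilde V_{h_\pm}\otimes W_{h_y}$ is defined by $\langle\tilde{\mathcal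 A}_{h_\pm,h_y}u,v\rangle_{H^1_0(\tilde\Omega)}=a_{\tilde\Omega}(u,v)$ for all $u,v\in\tilde V_{h_\pm}\otimes W_{h_y}$. $\|\cdot\|$ is the operator norm, with $\|\tilde{\mathcal A}_{h_\pm,h_y}^{-1}\|:=+\infty$ if the inverse does not exist. *)

(* Defs.v *)
From mathcomp Require Import all_boot all_order all_algebra.
From mathcomp Require Import all_classical all_reals all_analysis.

Set Implicit Arguments.
Unset Strict Implicit.
Unset Printing Implicit Defensive.

Import Order.TTheory GRing.Theory Num.Theory.
Import numFieldNormedType.Exports.

Local Open Scope classical_set_scope.
Local Open Scope ring_scope.

Section Spaces.
Context {R : realType}.
Implicit Types (a b : R) (I : set R) (f : R -> R).

(* In dimension one the elements of H^1_0(a, b) are the functions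
   x |-> \int_a^x g with g in L^2 that vanish at b.  We take this continuous
   representative and extend it by 0 outside [a, b], so that an element of
   H^1_0(a, b) is a single function on R. *)
Definition H10 a b : set (R -> R) :=
  [set f | [/\ exists2 g : R -> R, g \in Lfun (@lebesgue_measure R) 2%:E &
                 forall x, a <= x <= b ->
                   f x = \int[lebesgue_measure]_(t in `[a, x]) g t,
               f b = 0 &
               forall x, ~~ (a <= x <= b) -> f x = 0]].

Definition affine_on I f : Prop :=
  exists c d : R, forall x, I x -> f x = c * x + d.

Definition tensor_space (V W : set (R -> R)) : set (R * R -> R) :=
  [set u | exists (n : nat) (c : 'I_n -> R) (v w : 'I_n -> R -> R),
     (forall i, V (v i) /\ W (w i)) /\
     u = fun p => \sum_(i < n) c i * (v i p.1 * w i p.2)].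

(* Classical partial derivatives.  On finite sums of products of continuous
   piecewise affine functions they exist off finitely many mesh lines, and there
   they agree with the weak ones. *)
Definition dx (u : R * R -> R) (p : R * R) : R :=
  derive1 (fun x => u (x, p.2)) p.1.
Definition dy (u : R * R -> R) (p : R * R) : R :=
  derive1 (fun y => u (p.1, y)) p.2.

Definition grad_dot (u v : R * R -> R) (p : R * R) : R :=
  dx u p * dx v p + dy u p * dy v p.

Definition area : set (R * R) -> \bar R :=
  (@lebesgue_measure R \x @lebesgue_measure R)%E.

End Spaces.

Section Operator.
Context {R : realType}.
Variables (L sm sp : R).

Definition Omega : set (R * R) := `]- L, L[ `*` `]0, pi[.

(* The value at x = 0 is irrelevant: the line x = 0 has measure 0. *)
Definition sigma (x : R) : R := if x < 0 then sm else sp.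

Definition H1_inner (u v : R * R -> R) : R :=
  \int[area]_(p in Omega) grad_dot u v p.

Definition H1_norm (u : R * R -> R) : R := Num.sqrt (H1_inner u u).

Definition a_form (u v : R * R -> R) : R :=
  \int[area]_(p in Omega) (sigma p.1 * grad_dot u v p).

(* The operator norm of T on the subspace X; the supremum over the unit ball is
   0, not -oo, when X = 0. *)
Definition op_norm (X : set (R * R -> R)) (T : (R * R -> R) -> R * R -> R)
    : \bar R :=
  ereal_sup [set (H1_norm (T u))%:E | u in [set u | X u /\ H1_norm u <= 1]].

(* By Riesz there is exactly one such f in X when X is a finite-dimensional
   subspace of H^1_0. *)
Definition riesz_op (X : set (R * R -> R)) (u : R * R -> R) : R * R -> R :=
  xget (fun=> 0) [set f | X f /\ forall v, X v -> H1_inner f v = a_form u v].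

Definition invertible_on (X : set (R * R -> R)) (T : (R * R -> R) -> R * R -> R)
    : Prop := set_bij X X T.

Definition inv_norm (X : set (R * R -> R)) (T : (R * R -> R) -> R * R -> R)
    : \bar R :=
  if `[< invertible_on X T >] then op_norm X ('pinv_(fun=> fun=> 0) X T)
  else +oo%E.

Variables (Nm Np M : nat).

Definition h_minus : R := L / Nm%:R.
Definition h_plus : R := L / Np%:R.
Definition h_y : R := pi / M%:R.

Definition node (n : int) : R :=
  if (0 <= n)%R then h_plus * n%:~R else h_minus * n%:~R.

Definition V_h : set (R -> R) :=
  [set v | H10 (- L) L v /\
     forall n : int, (- Nm%:Z <= n < Np%:Z)%R ->
       affine_on `]node n, node (n + 1)[ v].

Definition W_h : set (R -> R) :=
  [set w | H10 0 pi w /\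
     forall m : nat, (m < M)%N ->
       affine_on `]h_y * m%:R, h_y * m.+1%:R[ w].

Definition X_h : set (R * R -> R) := tensor_space V_h W_h.

Definition A_h : (R * R -> R) -> R * R -> R := riesz_op X_h.

Definition admissible (r ry : R) : Prop :=
  [/\ (0 < Nm)%N, (0 < Np)%N, (0 < M)%N,
      h_plus = r * h_minus & h_y = ry * h_minus].

End Operator.

Section Bound.
Context {R : realType}.
Variables (sm kappa r ry eps : R).

Definition min_term (p : R) : R :=
  Num.min 1 (Num.min `|kappa| (Num.min
    (`|1 + (1 + p * eps) * kappa| / (2 + eps))
    (`|Num.sqrt (1 + ry ^+ 2)
        + (1 + p * eps) * kappa * Num.sqrt (r ^+ 2 + ry ^+ 2)|
     / (Num.sqrt (1 + ry ^+ 2)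
        + (1 + eps) * Num.sqrt (r ^+ 2 + ry ^+ 2))))).

Definition inv_bound : R :=
  1 / (`|sm| * Num.min (min_term 1) (min_term (- 1))).

End Bound.

(* Main.v *)
Require Import Defs.
From mathcomp Require Import all_boot all_order all_algebra.
From mathcomp Require Import all_classical all_reals all_analysis.
From mathcomp Require Import measurable_realfun ring lra zify.

(* The discrete sine vectors diagonalize both the mass and the stiffness matrix in
   y, so the discrete operator splits into one-dimensional operators for the forms
   [sigma (u' v' + lam u v)], one for every discrete frequency [lam].  Each of these
   has only three eigenvalues: [sm] and [sp], on the functions vanishing at the
   interface and supported on one side, and
     [(sm E- + sp E+) / (E- + E+)]
   on the discrete harmonic function that is 1 at the interface, where [E-], [E+] are
   its energies on the two sides.  All eigenspaces are orthogonal, so the norm of the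
   inverse is the largest inverse modulus of an eigenvalue.
   The energies are explicit.  With [rho = E+ / E-] the third eigenvalue is
   [sm (1 + kappa rho) / (1 + rho)], and up to a factor due to the outer boundary,
   which tends to 1 uniformly in the frequency as the mesh is refined, [rho] is
     [sqrt ((1 + lam h_plus^2 / 12) / (1 + lam h_minus^2 / 12))],
   which runs through the values strictly between 1 and
   [sqrt (r^2 + ry^2) / sqrt (1 + ry^2)].  Hence (i) bounds [1 + kappa rho] away from
   0, whereas in (ii) the value [rho = - 1 / kappa] lies in that interval and is
   approached, since the frequencies become dense. *)

Set Implicit Arguments.
Unset Strict Implicit.
Unset Printing Implicit Defensive.

Import Order.TTheory GRing.Theory Num.Theory.
Import numFieldNormedType.Exports.

Local Open Scope classical_set_scope.
Local Open Scope ring_scope.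

(** * Integration *)

(** The delicate point is uniformity in the frequency. For bounded [lam] the outer boundary does not
    become negligible: [cratio ^ N] tends to [exp (- 2 L sqrt lam)], so neither energy is close to
    its half-line value. But both halves have the same length [L], so the two boundary factors
    approach the same number and only their quotient [g] matters. To bring [g] uniformly near 1,
    [lam] must stay away from 0 ([4^-1 <= lam] on fine meshes) and [lam h^2] must stay bounded,
    which holds because [lam h_minus^2 = 6 tau / ry^2] with [tau] in (0, 2). The [eps] in the bound
    of (i) is exactly the room left for [g]. In (ii), [1 + kappa rho] with [g] set to 1 is at most a
    constant times the distance from the angle to the critical angle, so a neighbouring grid angle
    makes it of order [h_y], up to the error of [g]. *)

Section NullSets.
Local Open Scope ereal_scope.
Context d (T : measurableType d) (R : realType).
Variable mu : {measure set T -> \bar R}.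
Variable N : set T.
Hypotheses (mN : measurable N) (N0 : mu N = 0).
Import HBNNSimple.

Let ge0_integral_patchC (f : T -> \bar R) : (forall x, 0 <= f x) ->
  \int[mu]_x f x = \int[mu]_x (f \_ (~` N)) x.
Proof.
move=> f0; rewrite !ge0_integralTE//; last first.
  by move=> x; rewrite patchE; case: ifP.
apply/eqP; rewrite eq_le; apply/andP; split.
  apply: ge_ereal_sup => _ [h /= hf <-]; apply: ereal_sup_ubound => /=.
  exists (proj_nnsfun h (measurableC mN)).
    move=> x; rewrite -mrestrict !patchE; case: ifPn => // _; exact: hf.
  rewrite -[in LHS]mrestrict -(integral_nnsfun mu (measurableC mN)).
  rewrite -[RHS](_ : sintegral mu (h \_ setT) = _); last by rewrite patch_setT.
  rewrite -(integral_nnsfun mu measurableT).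
  rewrite (ge0_negligible_integral mN measurableT _ _ N0) ?setTD//.
    exact/measurable_EFinP.
  by move=> x _; rewrite lee_fin; exact: fun_ge0.
apply: ge_ereal_sup => _ [h /= hf <-]; apply: ereal_sup_ubound => /=.
exists h => // x; apply: le_trans (hf x) _.
by rewrite patchE; case: ifP.
Qed.

(* No measurability is asked of [f] and [g]: the integral of a nonnegative
   function is a supremum over simple functions, and these may be multiplied by
   the indicator of the complement of [N]. *)
Lemma eq_integral_off_null (D : set T) (f g : T -> \bar R) :
  (forall x, D x -> ~ N x -> f x = g x) ->
  \int[mu]_(x in D) f x = \int[mu]_(x in D) g x.
Proof.
move=> fg; rewrite integralE [in RHS]integralE.
have E (F G : T -> \bar R) : (forall x, 0 <= F x) -> (forall x, 0 <= G x) ->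
    (forall x, D x -> ~ N x -> F x = G x) ->
    \int[mu]_(x in D) F x = \int[mu]_(x in D) G x.
  move=> F0 G0 FG; rewrite integral_mkcond [RHS]integral_mkcond.
  rewrite ge0_integral_patchC; last by move=> x; rewrite patchE; case: ifP.
  rewrite [RHS]ge0_integral_patchC; last by move=> x; rewrite patchE; case: ifP.
  apply: eq_integral => x _; rewrite !patchE.
  case: ifPn => // xN; case: ifPn => // xD.
  by apply: FG; [rewrite inE in xD|rewrite inE in xN].
by congr (_ - _); apply: E => [x|x|x Dx Nx]; rewrite ?funepos_ge0 ?funeneg_ge0//
  ?funeposE ?funenegE fg.
Qed.

End NullSets.

Section ProductIntegral.
Context {R : realType}.
Local Notation mu := (@lebesgue_measure R).

Lemma integrable_prod (f g : R -> R) :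
  mu.-integrable setT (EFin \o f) -> mu.-integrable setT (EFin \o g) ->
  (mu \x mu)%E.-integrable setT (EFin \o (fun p => f p.1 * g p.2)).
Proof.
move=> fi gi.
have mf : measurable_fun setT f by apply/measurable_EFinP; exact: measurable_int fi.
have mg : measurable_fun setT g by apply/measurable_EFinP; exact: measurable_int gi.
apply/integrable12ltyP => /=.
  apply/measurable_EFinP; apply: measurable_funM.
    by apply: (measurableT_comp mf); exact: measurable_fst.
  by apply: (measurableT_comp mg); exact: measurable_snd.
have /integrableP[_ fo] := fi; have /integrableP[_ go] := gi.
under eq_integral.
  move=> x _.
  under eq_integral do rewrite normrM EFinM.
  rewrite ge0_integralZl//; last by apply/measurable_EFinP; exact: measurableT_comp.
  over.
rewrite /= ge0_integralZr//.
- by rewrite lte_mul_pinfty// ?integral_ge0// ge0_fin_numE// integral_ge0.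
- by apply/measurable_EFinP; exact: measurableT_comp.
- exact: integral_ge0.
Qed.

Lemma Rintegral_prod (f g : R -> R) :
  mu.-integrable setT (EFin \o f) -> mu.-integrable setT (EFin \o g) ->
  \int[(mu \x mu)%E]_p (f p.1 * g p.2) = (\int[mu]_x f x) * (\int[mu]_y g y).
Proof.
move=> fi gi; rewrite /Rintegral -fineM; last 2 first.
- exact: integrable_fin_num.
- exact: integrable_fin_num.
congr fine.
apply: etrans (esym (integral12_prod_meas1 (integrable_prod fi gi))) _.
rewrite /fubini_F/=; under eq_integral.
  move=> x _; under eq_integral do rewrite EFinM.
  rewrite integralZl//; over.
have gfin := integrable_fin_num measurableT gi.
by rewrite /= -(fineK gfin) integralZr.
Qed.

End ProductIntegral.

Section QuadraticIntegral.
Context {R : realType}.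
Local Notation mu := (@lebesgue_measure R).

Let quad (c p q r x : R) : R := p + q * (x - c) + r * (x - c) ^+ 2.
Let prim (c p q r x : R) : R :=
  p * (x - c) + q / 2 * (x - c) ^+ 2 + r / 3 * (x - c) ^+ 3.

Let prim_is_derive (c p q r x : R) : is_derive x (1 : R) (prim c p q r) (quad c p q r x).
Proof.
have d1 : is_derive x (1 : R) (fun x : R => x - c) 1.
  by apply: is_derive_eq; rewrite subr0.
have d2 : is_derive x (1 : R) (fun x : R => (x - c) ^+ 2) (2 * (x - c)).
  by apply: is_derive_eq; rewrite /GRing.scale/=; ring.
have d3 : is_derive x (1 : R) (fun x : R => (x - c) ^+ 3) (3 * (x - c) ^+ 2).
  by apply: is_derive_eq; rewrite /GRing.scale/=; ring.
by apply: is_derive_eq; rewrite /quad /GRing.scale/=; field.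
Qed.

Let quad_continuous (c p q r : R) : continuous (quad c p q r).
Proof.
move=> x; apply: cvgD; first apply: cvgD; first exact: cvg_cst.
  by apply: cvgMr; apply: cvgB => //; exact: cvg_cst.
apply: cvgMr; apply: (@continuous_comp _ _ _ (fun x => x - c) (fun y => y ^+ 2)).
  by apply: cvgB => //; exact: cvg_cst.
exact: exprn_continuous.
Qed.

(** Powers of [x - c] make all terms at the left end vanish; the half-open interval is the form in
    which cells tile a mesh. *)
Lemma integral_quadratic (c d p q r : R) : c < d ->
  mu.-integrable `[c, d[ (EFin \o (fun x => p + q * (x - c) + r * (x - c) ^+ 2)) /\
  (\int[mu]_(x in `[c, d[) (p + q * (x - c) + r * (x - c) ^+ 2)%:E
   = (p * (d - c) + q / 2 * (d - c) ^+ 2 + r / 3 * (d - c) ^+ 3)%:E)%E.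
Proof.
move=> cd.
have cq : {within `[c, d], continuous (quad c p q r)}.
  exact/continuous_subspaceT/quad_continuous.
have iq : mu.-integrable `[c, d] (EFin \o quad c p q r).
  by apply: continuous_compact_integrable => //; exact: segment_compact.
have iq' : mu.-integrable `[c, d[ (EFin \o quad c p q r).
  apply: integrableS iq => //; exact: subset_itv_co_cc.
split => //; rewrite integral_itv_bndo_bndc; last exact: measurable_int iq'.
have pc x : {for x, continuous (prim c p q r)}.
  apply: differentiable_continuous; apply/derivable1_diffP.
  by have [] := prim_is_derive c p q r x.
rewrite (continuous_FTC2 cd cq (F := prim c p q r)).
- rewrite -EFinB; congr EFin; rewrite /prim subrr; ring.
- split => [x _||].
  + by have [] := prim_is_derive c p q r x.
  + exact/cvg_at_right_filter/pc.
  + exact/cvg_at_left_filter/pc.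
- move=> x _; rewrite derive1E; have := prim_is_derive c p q r x.
  by move=> H; rewrite derive_val.
Qed.

End QuadraticIntegral.

(** * Meshes and integrals of piecewise quadratic functions *)

Section Mesh.
Context {R : realType}.
Local Notation mu := (@lebesgue_measure R).
Variables (z : nat -> R) (n : nat).
Hypothesis hz : forall i, z i < z i.+1.

Lemma mesh_lt i j : (i < j)%N -> z i < z j.
Proof.
exact: (@homo_ltn R z (fun x y => x < y) (fun y x w => @lt_trans _ _ y x w) hz i j).
Qed.

Lemma mesh_le i j : (i <= j)%N -> z i <= z j.
Proof. by rewrite leq_eqVlt => /predU1P[->//|/mesh_lt/ltW]. Qed.

Lemma mesh_cell x : z 0%N <= x -> x < z n ->
  exists i : 'I_n, z i <= x < z i.+1.
Proof.
elim: n => [|m IH] x0 xn; first by have := le_lt_trans x0 xn; rewrite ltxx.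
have [xm|mx] := ltP x (z m).
  by have [i iP] := IH x0 xm; exists (widen_ord (leqnSn m) i).
by exists ord_max; rewrite /= mx.
Qed.

(** Half-open, so that the first [n] cells are disjoint and cover [[z 0, z n[] exactly. *)
Definition cell (i : nat) : set R := `[z i, z i.+1[.

Lemma cell_indic i j x : z i <= x < z i.+1 ->
  \1_(cell j) x = (j == i)%:R :> R.
Proof.
move=> /andP[ix xi]; rewrite indicE; congr (_%:R); congr nat_of_bool.
apply/idP/idP => [|/eqP->]; last by rewrite mem_setE in_itv/= ix.
rewrite mem_setE in_itv/= => /andP[jx xj].
rewrite eqn_leq; apply/andP; split; rewrite leqNgt; apply/negP.
  by move=> /mesh_le; rewrite leNgt (le_lt_trans jx xi).
by move=> /mesh_le; rewrite leNgt (le_lt_trans ix xj).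
Qed.

Lemma cell_indic_out (i : 'I_n) x : ~~ (z 0%N <= x < z n) ->
  \1_(cell i) x = 0 :> R.
Proof.
move=> nx; rewrite indicE; apply/eqP; rewrite pnatr_eq0 eqb0.
apply: contra nx; rewrite mem_setE in_itv/= => /andP[jx xj].
by rewrite (le_trans (mesh_le (leq0n i)) jx) (lt_le_trans xj)// mesh_le.
Qed.

(** Products of two slopes and products of two affine functions both have this form. *)
Lemma piecewise_quadratic_integral (f : R -> R) (p q r : nat -> R) :
  (forall x, ~~ (z 0%N <= x < z n) -> f x = 0) ->
  (forall (i : 'I_n) x, z i <= x < z i.+1 ->
     f x = p i + q i * (x - z i) + r i * (x - z i) ^+ 2) ->
  mu.-integrable setT (EFin \o f) /\
  \int[mu]_x f x = \sum_(i < n) (p i * (z i.+1 - z i)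
     + q i / 2 * (z i.+1 - z i) ^+ 2 + r i / 3 * (z i.+1 - z i) ^+ 3).
Proof.
move=> fout fin.
pose g (i : 'I_n) x := p i + q i * (x - z i) + r i * (x - z i) ^+ 2.
have fE : EFin \o f = fun x => (\sum_(i < n) ((EFin \o g i) \_ (cell i)) x)%E.
  apply/funext => x /=.
  under eq_bigr do rewrite restrict_EFin /=.
  rewrite sumEFin; congr EFin.
  have gE (i : 'I_n) : (g i \_ (cell i)) x = g i x * \1_(cell i) x.
    by rewrite patchE indicE; case: ifPn => _; rewrite ?mulr1 ?mulr0.
  under eq_bigr do rewrite gE.
  have [xin|xout] := boolP (z 0%N <= x < z n); last first.
    by rewrite fout// big1// => i _; rewrite cell_indic_out// mulr0.
  have [j jx] := mesh_cell (andP xin).1 (andP xin).2.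
  rewrite (bigD1 j)//= (cell_indic _ jx) eqxx mulr1 big1 ?addr0; first exact: fin.
  by move=> i ij; rewrite (cell_indic _ jx) -[_ == _]/(i == j) (negPf ij) mulr0.
have gi (i : 'I_n) : mu.-integrable setT ((EFin \o g i) \_ (cell i)).
  have := (integral_quadratic (p i) (q i) (r i) (hz i)).1.
  by move=> gi; apply/integrable_restrict; rewrite ?setTI//; exact: measurable_itv.
split; first by rewrite fE; apply: integrable_sum.
rewrite /Rintegral -[X in fine (integral _ _ X)]/(EFin \o f) fE integral_sum//.
rewrite -[RHS]/(fine (_%:E)) -sumEFin; congr fine; apply: eq_bigr => i _.
by rewrite -integral_mkcond (integral_quadratic _ _ _ (hz i)).2.
Qed.

End Mesh.

(** * Continuous piecewise affine functions *)

Section Interpolant.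
Context {R : realType}.
Local Notation mu := (@lebesgue_measure R).
Variables (z : nat -> R) (n : nat).
Hypothesis hz : forall i, z i < z i.+1.
Implicit Types (U V : nat -> R).

Definition slope U i : R := (U i.+1 - U i) / (z i.+1 - z i).

(* On half-open cells, so that [pl U (z n) = 0] whatever [U n] is. *)
Definition pl U x : R :=
  \sum_(i < n) (U i + slope U i * (x - z i)) * \1_(cell z i) x.

Definition dpl U x : R := \sum_(i < n) slope U i * \1_(cell z i) x.

Lemma step_gt0 i : 0 < z i.+1 - z i.
Proof. by rewrite subr_gt0. Qed.

Lemma slopeK U i : slope U i * (z i.+1 - z i) = U i.+1 - U i.
Proof. by rewrite /slope divfK// gt_eqF// step_gt0. Qed.

Lemma sum_cell (F : nat -> R) (i : 'I_n) x : z i <= x < z i.+1 ->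
  \sum_(j < n) F j * \1_(cell z j) x = F i.
Proof.
move=> ix; rewrite (bigD1 i)//= (cell_indic hz _ ix) eqxx mulr1 big1 ?addr0//.
by move=> j ji; rewrite (cell_indic hz _ ix) -[_ == _]/(j == i) (negPf ji) mulr0.
Qed.

Lemma sum_cell_out (F : nat -> R) x : ~~ (z 0%N <= x < z n) ->
  \sum_(j < n) F j * \1_(cell z j) x = 0.
Proof. by move=> xout; rewrite big1// => i _; rewrite cell_indic_out ?mulr0. Qed.

Lemma pl_cell U (i : 'I_n) x : z i <= x < z i.+1 ->
  pl U x = U i + slope U i * (x - z i).
Proof. exact: (sum_cell (fun i => U i + slope U i * (x - z i))). Qed.

Lemma dpl_cell U (i : 'I_n) x : z i <= x < z i.+1 -> dpl U x = slope U i.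
Proof. exact: (sum_cell (slope U)). Qed.

Lemma pl_out U x : ~~ (z 0%N <= x < z n) -> pl U x = 0.
Proof. exact: (sum_cell_out (fun i => U i + slope U i * (x - z i))). Qed.

Lemma dpl_out U x : ~~ (z 0%N <= x < z n) -> dpl U x = 0.
Proof. exact: (sum_cell_out (slope U)). Qed.

Lemma pl_node U i : U n = 0 -> (i <= n)%N -> pl U (z i) = U i.
Proof.
move=> Un; rewrite leq_eqVlt => /predU1P[->|ni].
  by rewrite pl_out ?Un// ltxx andbF.
by rewrite (@pl_cell _ (Ordinal ni)) ?lexx ?hz//= subrr mulr0 addr0.
Qed.

Lemma pl_cell_closed U (i : 'I_n) x : U n = 0 -> z i <= x <= z i.+1 ->
  pl U x = U i + slope U i * (x - z i).
Proof.
move=> Un /andP[ix]; rewrite le_eqVlt => /predU1P[->|xi].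
  by rewrite pl_node// slopeK addrC subrK.
by rewrite (@pl_cell _ i)// ix.
Qed.

Lemma slope_sum (I : Type) (s : seq I) (c : I -> R) (U : I -> nat -> R) i :
  slope (fun j => \sum_(k <- s) c k * U k j) i = \sum_(k <- s) c k * slope (U k) i.
Proof.
rewrite /slope -sumrB mulr_suml; apply: eq_bigr => k _.
by rewrite -mulrBr mulrA.
Qed.

Lemma pl_sum (I : Type) (s : seq I) (c : I -> R) (U : I -> nat -> R) x :
  pl (fun j => \sum_(k <- s) c k * U k j) x = \sum_(k <- s) c k * pl (U k) x.
Proof.
rewrite /pl; under [RHS]eq_bigr do rewrite mulr_sumr.
rewrite [RHS]exchange_big/=; apply: eq_bigr => i _.
rewrite slope_sum mulr_suml -big_split/= mulr_suml.
by apply: eq_bigr => k _; ring.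
Qed.

Lemma derive1_pl U (i : 'I_n) x : z i < x < z i.+1 -> derive1 (pl U) x = slope U i.
Proof.
move=> /andP[ix xi].
have d : is_derive x (1 : R) (fun y => U i + slope U i * (y - z i)) (slope U i).
  by apply: is_derive_eq; rewrite /GRing.scale/=; ring.
rewrite derive1E (@near_eq_derive _ _ _ _ (fun y => U i + slope U i * (y - z i))).
  by rewrite derive_val.
have : \forall y \near x, y \in `]z i, z i.+1[ by apply: near_in_itvoo; rewrite in_itv/= ix.
apply: filterS => y; rewrite in_itv/= => /andP[iy yi].
by rewrite (@pl_cell _ i)// (ltW iy).
Qed.

Lemma dpl_integrable U : mu.-integrable setT (EFin \o dpl U).
Proof.
apply: (piecewise_quadratic_integral hz (p := slope U) (q := fun=> 0) (r := fun=> 0)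
  _ _).1 => [x /dpl_out//|i x /dpl_cell->].
by rewrite !mul0r !addr0.
Qed.

Lemma dpl_Lfun U : dpl U \in Lfun mu 2%:E.
Proof.
have mf : measurable_fun setT (dpl U).
  by apply/measurable_EFinP; exact: measurable_int (dpl_integrable U).
have i2 : mu.-integrable setT (EFin \o (fun x => dpl U x ^+ 2)).
  apply: (piecewise_quadratic_integral hz (p := fun i => slope U i ^+ 2)
    (q := fun=> 0) (r := fun=> 0) _ _).1.
    by move=> x /dpl_out ->; rewrite expr0n.
  by move=> i x /dpl_cell ->; rewrite !mul0r !addr0.
rewrite inE/=; apply/andP; split; first by rewrite inE.
rewrite inE/= /finite_norm unlock /Lnorm; apply: poweR_lty.
have /integrableP[_] := i2; apply: le_lt_trans.
apply: ge0_le_integral => //.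
- by move=> x _; rewrite lee_fin powR_ge0.
- apply/measurable_EFinP; apply: (@measurableT_comp _ _ _ _ _ _ (@powR R ^~ 2)) => //.
  exact: measurableT_comp.
- apply/measurable_EFinP; apply: measurableT_comp => //.
  by apply: measurable_funX.
- by move=> x _; rewrite /= lee_fin (powR_mulrn 2) ?normr_ge0// normrX.
Qed.

(** Cells closed on the right, so that the endpoint [z n] is reached too. *)
Lemma mesh_cell_oc x : z 0%N < x -> x <= z n ->
  exists i : 'I_n, z i < x <= z i.+1.
Proof.
elim: n => [|m IH] x0 xn; first by have := lt_le_trans x0 xn; rewrite ltxx.
have [xm|mx] := leP x (z m).
  by have [i iP] := IH x0 xm; exists (widen_ord (leqnSn m) i).
by exists ord_max; rewrite /= mx.
Qed.

(** On each full cell the slope integrates to the increment of [U], and the increments telescope. *)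
Lemma integral_dpl U x : U 0%N = 0 -> U n = 0 -> z 0%N <= x <= z n ->
  pl U x = \int[mu]_(t in `[z 0%N, x]) dpl U t.
Proof.
move=> U0 Un /andP[]; rewrite le_eqVlt => /predU1P[<-|x0] xn.
  by rewrite pl_node// U0 set_itv1 Rintegral_set1.
have [j jx] := mesh_cell_oc x0 xn; have /andP[jx1 jx2] := jx.
rewrite (@pl_cell_closed _ j)//; last by rewrite ltW.
rewrite -Rintegral_itv_bndo_bndc; last first.
  by apply: integrableS (dpl_integrable U).
(* The mesh cut off at [x]: the nodes up to [j], then [x], then further nodes that merely keep the
   sequence increasing. *)
pose z' i := if (i <= j)%N then z i else x + (i - j.+1)%:R.
have z'le i : (i <= j)%N -> z' i = z i by rewrite /z' => ->.
have z'j : z' j.+1 = x by rewrite /z' ltnn subnn addr0.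
have hz' i : z' i < z' i.+1.
  rewrite /z'; case: (ltngtP i j) => ij.
  - by rewrite hz.
  - by rewrite ltrD2l ltr_nat; lia.
  - by rewrite ij subnn addr0.
rewrite Rintegral_mkcond.
have [||_ ->] := piecewise_quadratic_integral hz' (n := j.+1)
    (f := (dpl U) \_ `[z 0%N, x[) (p := slope U) (q := fun=> 0) (r := fun=> 0).
- move=> t; rewrite z'j z'le// => tout.
  by rewrite patchE; case: ifPn => //; rewrite mem_setE in_itv/= (negPf tout).
- move=> i t; have ij : (i <= j)%N by rewrite -ltnS.
  rewrite !mul0r !addr0 (z'le _ ij) => /andP[it ti].
  have tx : t < z i.+1 /\ t < x.
    move: ti; rewrite /z'; case: ltnP => ij1 ti.
      by split=> //; apply: lt_le_trans ti _; rewrite (le_trans _ (ltW jx1))// mesh_le.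
    have -> : (i : nat) = j by apply/eqP; rewrite eqn_leq ij.
    move: ti; have -> : (i.+1 - j.+1 = 0)%N by lia.
    by rewrite addr0 => tx; split=> //; exact: lt_le_trans tx jx2.
  rewrite patchE mem_set/=; last first.
    by rewrite in_itv/= tx.2 andbT (le_trans _ it)// mesh_le.
  have ni : (i < n)%N := leq_ltn_trans ij (ltn_ord j).
  by rewrite (@dpl_cell _ (Ordinal ni))//= it tx.1.
rewrite big_ord_recr/= z'j (z'le j)// !mul0r !addr0; congr (_ + _).
under eq_bigr => i _ do
  rewrite (z'le i (ltnW (ltn_ord i))) (z'le i.+1 (ltn_ord i)) !mul0r !addr0 slopeK.
by rewrite -(big_mkord xpredT (fun i => U i.+1 - U i)) telescope_sumr// U0 subr0.
Qed.

Lemma pl_H10 U : U 0%N = 0 -> U n = 0 -> H10 (z 0%N) (z n) (pl U).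
Proof.
move=> U0 Un; split.
- by exists (dpl U); [exact: dpl_Lfun|move=> x /(integral_dpl U0 Un)].
- by rewrite pl_node.
- move=> x xout; apply: pl_out; apply: contra xout => /andP[-> /ltW].
  by [].
Qed.

Lemma pl_affine U i : (i < n)%N -> affine_on `]z i, z i.+1[ (pl U).
Proof.
move=> ni; exists (slope U i), (U i - slope U i * z i) => x /=.
rewrite in_itv/= => /andP[ix xi]; rewrite (@pl_cell _ (Ordinal ni))/=.
  by rewrite mulrBr; ring.
by rewrite (ltW ix).
Qed.

(** On a bounded interval L^2 lies in L^1, by [|g| <= 1 + |g|^2]. *)
Lemma Lfun2_integrable_itv (a b : R) g : g \in Lfun mu 2%:E ->
  mu.-integrable `[a, b] (EFin \o g).
Proof.
move=> g2; have := g2; rewrite inE => /andP[/[1!inE]/= mg _].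
have i2 : mu.-integrable `[a, b] (fun x => (1%:E + (`|g x| `^ 2)%:E)%E).
  apply: integrableD => //.
    apply: (measurable_bounded_integrable (f := cst 1)) => //.
      by rewrite /= lebesgue_measure_itv/=; case: ifPn => // _; rewrite -EFinB ltry.
    exact: bounded_cst.
  apply: integrableS (Lfun_integrable (r := 2) _ g2) => //.
  by rewrite ler1n.
apply: le_integrable i2 => //.
  by apply/measurable_EFinP; exact: measurable_funS mg.
move=> x _ /=; rewrite lee_fin (powR_mulrn 2)// [leRHS]ger0_norm ?addr_ge0 ?sqr_ge0//.
by have := sqr_ge0 (`|g x| - 1); nra.
Qed.

Lemma H10_continuous (a b : R) f : a < b -> H10 a b f ->
  {within `[a, b], continuous f}.
Proof.
move=> ab [[g g2 fE] _ _].
have c := parameterized_integral_continuous (ltW ab) (Lfun2_integrable_itv a b g2).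
apply: (subspace_eq_continuous _ c) => x.
by rewrite mem_setE in_itv/= => /fE.
Qed.

(** Affinity on open cells leaves the node values free; continuity of [H10] functions ties them to
    the one-sided limits. *)
Lemma H10_pl f : (0 < n)%N -> H10 (z 0%N) (z n) f ->
  (forall i, (i < n)%N -> affine_on `]z i, z i.+1[ f) ->
  f = pl (f \o z) /\ f (z 0%N) = 0 /\ f (z n) = 0.
Proof.
move=> n0 Hf aff; have z0n : z 0%N < z n by exact: mesh_lt.
have cf := H10_continuous z0n Hf.
case: Hf => [[g _ fE] fn0 fout].
have f00 : f (z 0%N) = 0.
  by rewrite fE ?lexx ?ltW// set_itv1 Rintegral_set1.
split => //; apply/funext => x.
have [xin|xout] := boolP (z 0%N <= x < z n); last first.
  rewrite pl_out//; have [->|xn] := eqVneq x (z n); first by [].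
  by apply: fout; apply: contra xout => /andP[-> xn']; rewrite lt_neqAle xn.
have [i /[dup] ix /andP[ix1 ix2]] := mesh_cell (andP xin).1 (andP xin).2.
rewrite (pl_cell _ ix)/=.
have [c [d cd]] := aff i (ltn_ord i).
have ci : {within `[z i, z i.+1], continuous f}.
  apply: continuous_subspaceW cf => y /=; rewrite !in_itv/= => /andP[y1 y2].
  by rewrite (le_trans (mesh_le hz (leq0n i)) y1) (le_trans y2)// mesh_le.
have [_ cr cl] := (continuous_within_itvP f (hz i)).1 ci.
have lc (y : R) : (fun t => c * t + d) t @[t --> y] --> c * y + d.
  by apply: cvgD; [apply: cvgMr; exact: cvg_id|exact: cvg_cst].
have fl : f (z i) = c * z i + d.
  rewrite -(cvg_lim _ cr)//; apply: cvg_lim => //.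
  apply: cvg_trans (cvg_at_right_filter (lc _)); apply: near_eq_cvg.
  near=> t; rewrite [RHS]cd//= in_itv/=; apply/andP; split.
    by near: t; exact: nbhs_right_gt.
  by near: t; exact: nbhs_right_lt.
have fr : f (z i.+1) = c * z i.+1 + d.
  rewrite -(cvg_lim _ cl)//; apply: cvg_lim => //.
  apply: cvg_trans (cvg_at_left_filter (lc _)); apply: near_eq_cvg.
  near=> t; rewrite [RHS]cd//= in_itv/=; apply/andP; split.
    by near: t; exact: nbhs_left_gt.
  by near: t; exact: nbhs_left_lt.
have sl : slope (f \o z) i = c.
  by rewrite /slope/= fl fr opprD addrACA subrr addr0 -mulrBr mulfK// gt_eqF// step_gt0.
rewrite sl fl; move: ix1; rewrite le_eqVlt => /predU1P[<-|ix1].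
  by rewrite subrr mulr0 addr0.
by rewrite cd/= ?in_itv/= ?ix1// ; ring.
Unshelve. all: by end_near. Qed.

End Interpolant.

(** * The two-dimensional forms *)

Section RintegralSum.
Context d (T : measurableType d) (R : realType).
Variable mu : {measure set T -> \bar R}.

Lemma Rintegral_sum (I : Type) (s : seq I) (f : I -> T -> R) :
  (forall k, mu.-integrable setT (EFin \o f k)) ->
  \int[mu]_x (\sum_(k <- s) f k x) = \sum_(k <- s) \int[mu]_x f k x.
Proof.
move=> fi; rewrite /Rintegral.
under eq_integral do rewrite -sumEFin.
rewrite (@integral_sum _ _ _ _ _ measurableT _ (fun k => EFin \o f k))//.
rewrite [RHS](_ : _ = \sum_(k <- s) fine (\int[mu]_x (EFin \o f k) x)%E)//.
rewrite -[RHS]/(fine (_%:E)) -sumEFin; congr fine; apply: eq_bigr => k _.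
by rewrite fineK//; exact: integrable_fin_num.
Qed.

Lemma integrable_sumR (I : Type) (s : seq I) (f : I -> T -> R) :
  (forall k, mu.-integrable setT (EFin \o f k)) ->
  mu.-integrable setT (EFin \o (fun x => \sum_(k <- s) f k x)).
Proof.
move=> fi; rewrite (_ : _ \o _ = fun x => (\sum_(k <- s) (EFin \o f k) x)%E).
  by apply: integrable_sum.
by apply/funext => x /=; rewrite sumEFin.
Qed.

End RintegralSum.

Section Forms.
Context {R : realType}.
Local Notation mu := (@lebesgue_measure R).

Definition stiff (z : nat -> R) n (s U V : nat -> R) : R :=
  \sum_(i < n) s i * (slope z U i * slope z V i * (z i.+1 - z i)).

(** Each summand is [s i] times the exact integral over the cell of a product of two affine
    functions, in terms of their end values. *)
Definition mass (z : nat -> R) n (s U V : nat -> R) : R :=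
  \sum_(i < n) s i * ((z i.+1 - z i) / 6 *
    (2 * U i * V i + U i * V i.+1 + U i.+1 * V i + 2 * U i.+1 * V i.+1)).

Section OneDim.
Variables (z : nat -> R) (n : nat) (s : nat -> R) (S : R -> R).
Hypothesis hz : forall i, z i < z i.+1.
Hypothesis hS : forall (i : 'I_n) x, z i <= x < z i.+1 -> S x = s i.

Lemma integral_dpl2 U V :
  mu.-integrable setT (EFin \o (fun x => S x * (dpl z n U x * dpl z n V x))) /\
  \int[mu]_x (S x * (dpl z n U x * dpl z n V x)) = stiff z n s U V.
Proof.
have [||i E] := piecewise_quadratic_integral hz (n := n)
  (f := fun x => S x * (dpl z n U x * dpl z n V x))
  (p := fun i => s i * (slope z U i * slope z V i)) (q := fun=> 0) (r := fun=> 0).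
- by move=> x xout; rewrite dpl_out// mul0r mulr0.
- by move=> i x ix; rewrite (hS ix) !(dpl_cell hz _ ix) !mul0r !addr0.
- split => //; rewrite E; apply: eq_bigr => j _; ring.
Qed.

Lemma integral_pl2 U V :
  mu.-integrable setT (EFin \o (fun x => S x * (pl z n U x * pl z n V x))) /\
  \int[mu]_x (S x * (pl z n U x * pl z n V x)) = mass z n s U V.
Proof.
have [||i E] := piecewise_quadratic_integral hz (n := n)
  (f := fun x => S x * (pl z n U x * pl z n V x))
  (p := fun i => s i * (U i * V i))
  (q := fun i => s i * (U i * slope z V i + slope z U i * V i))
  (r := fun i => s i * (slope z U i * slope z V i)).
- by move=> x xout; rewrite pl_out// mul0r mulr0.
- by move=> i x ix; rewrite (hS ix) !(pl_cell hz _ ix); ring.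
- split => //; rewrite E; apply: eq_bigr => j _.
  have UE : U j.+1 = U j + slope z U j * (z j.+1 - z j) by rewrite slopeK// addrC subrK.
  have VE : V j.+1 = V j + slope z V j * (z j.+1 - z j) by rewrite slopeK// addrC subrK.
  by rewrite UE VE; field.
Qed.

End OneDim.

Section TwoDim.
Variables (z y : nat -> R) (n m : nat) (s : nat -> R) (S : R -> R).
Hypotheses (hz : forall i, z i < z i.+1) (hy : forall i, y i < y i.+1).
Hypothesis hS : forall (i : 'I_n) x, z i <= x < z i.+1 -> S x = s i.

Definition tp K (U W : 'I_K -> nat -> R) (p : R * R) : R :=
  \sum_(k < K) pl z n (U k) p.1 * pl y m (W k) p.2.

(** All mesh lines: the null set on which classical partial derivatives need not match the cellwise
    slopes. *)
Let Nodes : set (measurableTypeR R * measurableTypeR R) :=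
  (range z `*` setT) `|` (setT `*` range y).

Let measurable_nodes (w : nat -> R) : measurable (range w : set (measurableTypeR R)).
Proof.
apply: countable_measurable; first by move=> t; exact: measurable_set1.
exact: card_image_le.
Qed.

Let nodes0 (w : nat -> R) : mu (range w) = 0%E.
Proof. by apply: countable_lebesgue_measure0; exact: card_image_le. Qed.

Let mNodes : measurable Nodes.
Proof. by apply: measurableU; apply: measurableX. Qed.

Let Nodes0 : (mu \x mu)%E Nodes = 0%E.
Proof.
apply/eqP; rewrite -measure_le0; apply: (le_trans (measureU2 _ _ _)).
- exact: measurableX.
- exact: measurableX.
have e1 : (mu \x mu)%E (range z `*` setT) = 0%E.
  by apply: (eq_trans (product_measure1E _ _ (measurable_nodes z) measurableT));
    rewrite [X in (X * _)%E]nodes0 mul0e.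
have e2 : (mu \x mu)%E (setT `*` range y) = 0%E.
  by apply: (eq_trans (product_measure1E _ _ measurableT (measurable_nodes y)));
    rewrite [X in (_ * X)%E]nodes0 mule0.
by rewrite [X in (X + _)%E]e1 [X in (_ + X)%E]e2 adde0.
Qed.

Lemma open_cell (w : nat -> R) N t : (forall i, w i < w i.+1) ->
  w 0%N <= t < w N -> ~ range w t -> exists i : 'I_N, w i < t < w i.+1.
Proof.
move=> hw /andP[t0 tN] nt; have [i /andP[i1 i2]] := mesh_cell t0 tN.
exists i; rewrite i2 andbT lt_neqAle i1 andbT; apply/eqP => it.
by apply: nt; exists i.
Qed.

(** For a fixed second variable, [tp] is again a single interpolant in [x], since [pl] is linear in
    the nodal values. *)
Lemma dx_tp K (U W : 'I_K -> nat -> R) p (i : 'I_n) : z i < p.1 < z i.+1 ->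
  dx (tp U W) p = \sum_(k < K) dpl z n (U k) p.1 * pl y m (W k) p.2.
Proof.
move=> ip; rewrite /dx /tp/=.
rewrite (_ : (fun x => _) = pl z n (fun j => \sum_(k < K) pl y m (W k) p.2 * U k j)).
  rewrite (derive1_pl hz _ ip) slope_sum; apply: eq_bigr => k _.
  by case/andP: ip => ip1 ip2; rewrite (@dpl_cell _ _ _ hz _ i) 1?mulrC// ltW.
apply/funext => x; rewrite pl_sum//.
by apply: eq_bigr => k _; rewrite mulrC.
Qed.

Lemma dy_tp K (U W : 'I_K -> nat -> R) p (j : 'I_m) : y j < p.2 < y j.+1 ->
  dy (tp U W) p = \sum_(k < K) pl z n (U k) p.1 * dpl y m (W k) p.2.
Proof.
move=> jp; rewrite /dy /tp/=.
rewrite (_ : (fun x => _) = pl y m (fun j => \sum_(k < K) pl z n (U k) p.1 * W k j)).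
  rewrite (derive1_pl hy _ jp) slope_sum; apply: eq_bigr => k _.
  by case/andP: jp => jp1 jp2; rewrite (@dpl_cell _ _ _ hy _ j)// ltW.
by apply/funext => x; rewrite pl_sum.
Qed.

Let sum_mul2 K K' (c : R) (a a' : 'I_K -> R) (b b' : 'I_K' -> R) :
  c * ((\sum_k a k) * (\sum_l b l) + (\sum_k a' k) * (\sum_l b' l)) =
  \sum_k \sum_l (c * (a k * b l) + c * (a' k * b' l)).
Proof.
rewrite !big_distrlr/= -big_split/= mulr_sumr; apply: eq_bigr => k _.
by rewrite -big_split/= mulr_sumr; apply: eq_bigr => l _; rewrite mulrDr.
Qed.

(** Off the mesh lines the integrand is a finite sum of products of a function of [x] and a function
    of [y]; the coefficient depends on [x] alone and enters only the first factors. *)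
Lemma integral_grad K K' (U W : 'I_K -> nat -> R) (U' W' : 'I_K' -> nat -> R) :
  \int[area]_(p in `]z 0%N, z n[ `*` `]y 0%N, y m[)
     (S p.1 * grad_dot (tp U W) (tp U' W') p) =
  \sum_(k < K) \sum_(l < K')
    (stiff z n s (U k) (U' l) * mass y m (fun=> 1) (W k) (W' l) +
     mass z n s (U k) (U' l) * stiff y m (fun=> 1) (W k) (W' l)).
Proof.
pose F k l p : R := S p.1 * (dpl z n (U k) p.1 * dpl z n (U' l) p.1) *
    (1 * (pl y m (W k) p.2 * pl y m (W' l) p.2)) +
  S p.1 * (pl z n (U k) p.1 * pl z n (U' l) p.1) *
    (1 * (dpl y m (W k) p.2 * dpl y m (W' l) p.2)).
have h1 (j : 'I_m) (x : R) : y j <= x < y j.+1 -> (fun=> 1) x = (fun=> 1) j :> R by [].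
rewrite Rintegral_mkcond.
transitivity (\int[(mu \x mu)%E]_p (\sum_(k < K) \sum_(l < K') F k l p)).
  rewrite /Rintegral /area; congr fine.
  apply: (eq_integral_off_null mNodes Nodes0) => -[p q] _ pq; congr EFin.
  have pz : ~ range z p by move=> H; apply: pq; left.
  have qy : ~ range y q by move=> H; apply: pq; right.
  rewrite patchE; case: ifPn => [|pqout].
    rewrite inE => -[/=]; rewrite !in_itv/= => /andP[p1 p2] /andP[q1 q2].
    have [|i ip] := @open_cell z n p hz _ pz; first by rewrite p2 ltW.
    have [|j jq] := @open_cell y m q hy _ qy; first by rewrite q2 ltW.
    rewrite /grad_dot !(@dx_tp _ _ _ (p, q) i ip) !(@dy_tp _ _ _ (p, q) j jq)/=.
    rewrite sum_mul2; apply: eq_bigr => k _; apply: eq_bigr => l _.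
    by rewrite /F/= !mul1r; ring.
  rewrite big1// => k _; rewrite big1// => l _; rewrite /F/=.
  have [pin|pout] := boolP (z 0%N <= p < z n); last first.
    by rewrite !(dpl_out hz _ pout) !(pl_out hz _ pout) !(mul0r, mulr0) addr0.
  have [qin|qout] := boolP (y 0%N <= q < y m); last first.
    by rewrite !(dpl_out hy _ qout) !(pl_out hy _ qout) !(mul0r, mulr0) addr0.
  (* A point of the half-open rectangle off the mesh lines lies in the open one. *)
  exfalso; move: pqout; rewrite notin_setE; apply; split => /=; rewrite in_itv/=.
    move/andP: pin => [p1 ->]; rewrite andbT lt_neqAle p1 andbT.
    by apply/eqP => p0; apply: pz; exists 0%N.
  move/andP: qin => [q1 ->]; rewrite andbT lt_neqAle q1 andbT.
  by apply/eqP => q0; apply: qy; exists 0%N.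
have i1 k l := (integral_dpl2 hz hS (U k) (U' l)).1.
have i2 k l := (integral_pl2 hz hS (U k) (U' l)).1.
have i3 k l := (integral_dpl2 (s := fun=> 1) (S := fun=> 1) hy h1 (W k) (W' l)).1.
have i4 k l := (integral_pl2 (s := fun=> 1) (S := fun=> 1) hy h1 (W k) (W' l)).1.
have Fi k l : (mu \x mu)%E.-integrable setT (EFin \o F k l).
  exact: (integrableD measurableT (integrable_prod (i1 k l) (i4 k l))
    (integrable_prod (i2 k l) (i3 k l))).
have Fsi k : (mu \x mu)%E.-integrable setT
    (EFin \o (fun p => \sum_(l < K') F k l p)).
  exact: (integrable_sumR _ (Fi k)).
apply: (etrans (Rintegral_sum _ Fsi)).
apply: eq_bigr => k _; apply: (etrans (Rintegral_sum _ (Fi k))).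
apply: eq_bigr => l _.
apply: (etrans (RintegralD measurableT (integrable_prod (i1 k l) (i4 k l))
  (integrable_prod (i2 k l) (i3 k l)))).
rewrite (Rintegral_prod (i1 k l) (i4 k l)) (Rintegral_prod (i2 k l) (i3 k l)).
rewrite (integral_dpl2 hz hS _ _).2 (integral_pl2 hz hS _ _).2.
by rewrite (integral_dpl2 (s := fun=> 1) (S := fun=> 1) hy h1 _ _).2
  (integral_pl2 (s := fun=> 1) (S := fun=> 1) hy h1 _ _).2.
Qed.

End TwoDim.
End Forms.

(** * Discrete sines *)

Section DiscreteSine.
Context {R : realType}.
Variable M : nat.
Hypothesis M0 : (0 < M)%N.
Local Notation h := (pi / M%:R : R).

Lemma cos_natpi p : cos (p%:R * pi) = (-1) ^+ p :> R.
Proof.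
elim: p => [|p IH]; first by rewrite mul0r cos0 expr0.
by rewrite -natr1 mulrDl mul1r cosDpi IH exprS mulN1r.
Qed.

Lemma sin_natpi p : sin (p%:R * pi) = 0 :> R.
Proof.
elim: p => [|p IH]; first by rewrite mul0r sin0.
by rewrite -natr1 mulrDl mul1r sinDpi IH oppr0.
Qed.

Let M_neq0 : M%:R != 0 :> R. Proof. by rewrite pnatr_eq0 -lt0n. Qed.

(** With [x] the half angle, [2 sin x cos (2 j x)] is a difference of consecutive sines, so the sum
    telescopes; [p < 2 M] keeps [sin x] nonzero. *)
Lemma sum_cos p : (0 < p < M.*2)%N ->
  \sum_(j < M) cos (p%:R * j%:R * h) = (1 - (-1) ^+ p) / 2.
Proof.
move=> /andP[p0 pM]; set x := p%:R * h / 2.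
have x0 : 0 < sin x.
  have pM2 : p%:R < 2 * M%:R :> R by rewrite -natrM ltr_nat mul2n.
  apply: sin_gt0_pi; apply/andP; split.
    by rewrite /x divr_gt0// mulr_gt0 ?ltr0n// divr_gt0 ?pi_gt0 ?ltr0n.
  rewrite /x ltr_pdivrMr// mulrA ltr_pdivrMr ?ltr0n//.
  by move: (pi : R) (pi_gt0 R) => P P0; nra.
apply: (mulIf (lt0r_neq0 (mulr_gt0 (ltr0Sn R 1) x0))).
pose F j := sin (2 * j%:R * x - x).
rewrite mulr_suml (eq_bigr (fun j : 'I_M => F j.+1 - F j)); last first.
  move=> j _; rewrite /F.
  have -> : p%:R * j%:R * h = 2 * j%:R * x by rewrite /x; field.
  have -> : 2 * j.+1%:R * x - x = 2 * j%:R * x + x by rewrite -natr1; ring.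
  by rewrite sinD sinB; ring.
rewrite -(big_mkord xpredT (fun j => F j.+1 - F j)) telescope_sumr// /F.
have -> : 2 * M%:R * x = p%:R * pi by rewrite /x; field.
by rewrite mulr0 mul0r sub0r sinN sinB sin_natpi cos_natpi; field.
Qed.

(** Product-to-sum: [k - l] and [k + l] have the same parity, so the two cosine sums cancel unless
    [k = l]. *)
Lemma sine_orthogonal k l : (0 < k < M)%N -> (0 < l < M)%N ->
  \sum_(j < M) sin (k%:R * j%:R * h) * sin (l%:R * j%:R * h)
  = if k == l then M%:R / 2 else 0.
Proof.
wlog kl : k l / (l <= k)%N => [H kM lM|].
  case: (leqP l k) => [lk|/ltnW kl]; first exact: H.
  rewrite eq_sym -H//; apply: eq_bigr => j _; exact: mulrC.
move=> /andP[k0 kM] /andP[l0 lM].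
rewrite (eq_bigr (fun j : 'I_M => (cos ((k - l)%:R * j%:R * h) -
    cos ((k + l)%:R * j%:R * h)) / 2)); last first.
  move=> j _; rewrite natrB// natrD !mulrBl !mulrDl cosB cosD; by field.
rewrite -mulr_suml sumrB (sum_cos (p := k + l)); last by rewrite -addnn; lia.
case: eqVneq => [->|kl'].
  rewrite subnn (eq_bigr (fun=> 1)); last by move=> j _; rewrite !mul0r cos0.
  by rewrite sumr_const card_ord addnn -signr_odd odd_double expr0 subrr mul0r subr0.
rewrite (sum_cos (p := k - l)); last by lia.
have -> : (k + l = (k - l) + l.*2)%N by rewrite -addnn; lia.
by rewrite exprD -[(-1) ^+ l.*2]signr_odd odd_double mulr1 subrr mul0r.
Qed.

(* The index [k] stands for the frequency [k.+1]. *)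
Definition sn (k j : nat) : R := sin (k.+1%:R * j%:R * h).

Lemma sn0 k : sn k 0%N = 0.
Proof. by rewrite /sn mulr0 mul0r sin0. Qed.

Lemma snM k : sn k M = 0.
Proof. by rewrite /sn -mulrA [_ * h]mulrC divfK// sin_natpi. Qed.

(** Solved for the earliest value, so that [2 cos * sn k j - sn k j.+1] can stand for the value at
    [j - 1], even for [j = 0]. *)
Lemma sn_rec k j : 2 * cos (k.+1%:R * h) * sn k j.+1 - sn k j.+2 = sn k j.
Proof.
have e : k.+1%:R * j.+2%:R * h = k.+1%:R * j.+1%:R * h + k.+1%:R * h.
  by rewrite -[j.+2%:R]natr1; ring.
have e' : k.+1%:R * j%:R * h = k.+1%:R * j.+1%:R * h - k.+1%:R * h.
  by rewrite -[j.+1%:R]natr1; ring.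
by rewrite /sn e e' sinD sinB; ring.
Qed.

Lemma sn_orthogonal (k l : 'I_M.-1) :
  \sum_(j < M) sn k j * sn l j = if k == l then M%:R / 2 else 0.
Proof.
rewrite (sine_orthogonal (k := k.+1) (l := l.+1)) ?eqSS//.
- by have := ltn_ord k; lia.
- by have := ltn_ord l; lia.
Qed.

Let sum_ord_pred (F : nat -> R) : F 0%N = 0 ->
  \sum_(k < M) F k = \sum_(k < M.-1) F k.+1.
Proof.
by move=> F0; rewrite -[in LHS](prednK M0) big_ord_recl F0 add0r.
Qed.

(** The matrix [sin (k j h)] is symmetric in [k] and [j], so orthogonality in one index gives
    completeness in the other. *)
Lemma sn_complete (W : nat -> R) : W 0%N = 0 -> W M = 0 -> forall j, (j <= M)%N ->
  W j = \sum_(k < M.-1) (2 / M%:R * \sum_(i < M) W i * sn k i) * sn k j.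
Proof.
move=> W0 WM j; have [->|j0] := posnP j.
  by move=> _; rewrite W0 big1// => k _; rewrite sn0 mulr0.
rewrite leq_eqVlt => /predU1P[->|jM].
  by rewrite WM big1// => k _; rewrite snM mulr0.
under eq_bigr do rewrite -mulrA mulr_suml mulr_sumr.
rewrite exchange_big/= (bigD1 (Ordinal jM))//=.
have S i : (0 < i < M)%N -> \sum_(k < M.-1) sn k i * sn k j =
    if i == j then M%:R / 2 else 0.
  move=> iM; rewrite -(sine_orthogonal iM) ?j0//.
  rewrite (sum_ord_pred (F := fun k => sin (i%:R * k%:R * h) * sin (j%:R * k%:R * h)));
    last by rewrite mulr0 mul0r sin0 mul0r.
  by apply: eq_bigr => k _; rewrite /sn ![_ * k.+1%:R]mulrC.
rewrite (eq_bigr (fun k : 'I_M.-1 => 2 / M%:R * W j * (sn k j * sn k j))); last first.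
  by move=> k _; ring.
rewrite -mulr_sumr S ?j0// eqxx big1 ?addr0; first by field.
move=> i ij; have [i0|i0] := posnP i.
  by rewrite big1// => k _; rewrite i0 W0 mul0r !(mul0r, mulr0).
rewrite (eq_bigr (fun k : 'I_M.-1 => 2 / M%:R * W i * (sn k i * sn k j))); last first.
  by move=> k _; ring.
rewrite -mulr_sumr S ?i0 ?ltn_ord// ifN ?mulr0//.
Qed.

Definition ymesh (j : nat) : R := h * j%:R.

Lemma ymesh_step j : ymesh j.+1 - ymesh j = h.
Proof. by rewrite /ymesh -natr1; ring. Qed.

Lemma ymesh_lt j : ymesh j < ymesh j.+1.
Proof. by rewrite -subr_gt0 ymesh_step divr_gt0 ?pi_gt0 ?ltr0n. Qed.

Definition ymass (k : nat) : R := h / 6 * (4 + 2 * cos (k.+1%:R * h)) * (M%:R / 2).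

(** The generalized eigenvalue of the sine vector: its stiffness factor [(2 - 2 cos) / h] over its
    mass factor [h (4 + 2 cos) / 6]. *)
Definition ylambda (k : nat) : R :=
  6 / h ^+ 2 * ((1 - cos (k.+1%:R * h)) / (2 + cos (k.+1%:R * h))).

Let h_gt0 : 0 < h. Proof. by rewrite divr_gt0 ?pi_gt0 ?ltr0n. Qed.

Lemma mass_sn (k : nat) V : V 0%N = 0 -> V M = 0 ->
  mass ymesh M (fun=> 1) (sn k) V =
  h / 6 * (4 + 2 * cos (k.+1%:R * h)) * \sum_(j < M) sn k j * V j.
Proof.
move=> V0 VM; set c := cos _; apply/eqP; rewrite -subr_eq0; apply/eqP.
rewrite mulr_sumr -sumrB.
(* A summation by parts; the bracket is the value of [sn k] at [j - 1], and the boundary terms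
   vanish with [V]. *)
pose F j := h / 6 * (2 * sn k j * V j + (2 * c * sn k j - sn k j.+1) * V j).
rewrite (eq_bigr (fun j : 'I_M => F j.+1 - F j)).
  rewrite -(big_mkord xpredT (fun j => F j.+1 - F j)) telescope_sumr// /F V0 VM.
  by ring.
by move=> j _; rewrite /F ymesh_step sn_rec; ring.
Qed.

Lemma stiff_sn (k : nat) V : V 0%N = 0 -> V M = 0 ->
  stiff ymesh M (fun=> 1) (sn k) V =
  (2 - 2 * cos (k.+1%:R * h)) / h * \sum_(j < M) sn k j * V j.
Proof.
move=> V0 VM; set c := cos _; apply/eqP; rewrite -subr_eq0; apply/eqP.
rewrite mulr_sumr -sumrB.
pose F j := (sn k j * V j - (2 * c * sn k j - sn k j.+1) * V j) / h.
rewrite (eq_bigr (fun j : 'I_M => F j.+1 - F j)).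
  rewrite -(big_mkord xpredT (fun j => F j.+1 - F j)) telescope_sumr// /F V0 VM.
  by ring.
move=> j _; rewrite /F /slope !ymesh_step sn_rec; clearbody c.
by move: h h_gt0 => q q0; field; rewrite gt_eqF.
Qed.

Lemma mass_snsn (k l : 'I_M.-1) :
  mass ymesh M (fun=> 1) (sn k) (sn l) = if k == l then ymass k else 0.
Proof.
rewrite mass_sn ?sn0 ?snM// sn_orthogonal.
by case: ifP => _; rewrite ?mulr0.
Qed.

Lemma cos_gtN1 (k : 'I_M.-1) : -1 < cos (k.+1%:R * h) < 1.
Proof.
have kM : (k.+1 < M)%N by have := ltn_ord k; lia.
have s0 : 0 < sin (k.+1%:R * h).
  apply: sin_gt0_pi; apply/andP; split; first by rewrite mulr_gt0 ?ltr0n.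
  by rewrite mulrA ltr_pdivrMr ?ltr0n// mulrC ltr_pM2l ?pi_gt0// ltr_nat.
have := cos2Dsin2 (k.+1%:R * h); nra.
Qed.

Lemma stiff_snsn (k l : 'I_M.-1) :
  stiff ymesh M (fun=> 1) (sn k) (sn l) = if k == l then ylambda k * ymass k else 0.
Proof.
rewrite stiff_sn ?sn0 ?snM// sn_orthogonal.
have /andP[c1 _] := cos_gtN1 k.
case: ifP => _; rewrite ?mulr0// /ylambda /ymass.
move: (cos _) c1 => c c1; move: h h_gt0 => q q0; field.
by rewrite !gt_eqF//; lra.
Qed.

Lemma ymass_gt0 (k : 'I_M.-1) : 0 < ymass k.
Proof.
have /andP[c1 _] := cos_gtN1 k.
have c4 : 0 < 4 + 2 * cos (k.+1%:R * h) by lra.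
by rewrite /ymass; repeat apply: mulr_gt0 => //; rewrite ?invr_gt0 ?ltr0n.
Qed.

Lemma ylambda_gt0 (k : 'I_M.-1) : 0 < ylambda k.
Proof.
have /andP[c1 c2] := cos_gtN1 k.
rewrite /ylambda; apply: mulr_gt0; first by rewrite divr_gt0// exprn_gt0.
by apply: divr_gt0; lra.
Qed.

End DiscreteSine.

(** * Discrete harmonic functions *)

Section DiscreteHarmonic.
Context {R : realType}.
Variables (h lam : R) (N : nat).
Hypotheses (h0 : 0 < h) (lam0 : 0 < lam) (N0 : (0 < N)%N).

(* Diagonal and off-diagonal entries of the element matrix of [u' v' + lam u v]
   on a cell of length [h]. *)
Definition cdiag : R := h^-1 + lam * h / 3.
Definition coff : R := - h^-1 + lam * h / 6.

(** The square root of [cdiag^2 - coff^2], and also the energy on a half-line: the limit of [energy]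
    as [N] grows with [h] and [lam] fixed. *)
Definition csqrt : R := Num.sqrt (lam * (1 + lam * h ^+ 2 / 12)).

(* The root of [coff (1 + q^2) + 2 cdiag q = 0] in (-1, 1), in a form that is also
   valid when [coff = 0]. *)
Definition hq : R := - coff / (cdiag + csqrt).

(* [cratio ^ N = hq ^ (2 N)] measures the influence of the outer boundary. *)
Definition cratio : R := (cdiag - csqrt) / (cdiag + csqrt).

Definition energy : R := csqrt * ((1 + cratio ^+ N) / (1 - cratio ^+ N)).

(** The combination of [hq ^ n] and [hq ^ (- n)] that is 1 at 0 and vanishes at [N], written without
    negative powers because [hq] may be 0. *)
Definition harm (n : nat) : R := (hq ^+ n - hq ^+ (N.*2 - n)) / (1 - cratio ^+ N).

Lemma csqrt_gt0 : 0 < csqrt.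
Proof.
rewrite sqrtr_gt0 mulr_gt0// ltr_wpDr// divr_ge0// mulr_ge0 ?sqr_ge0//.
exact: ltW.
Qed.

Lemma csqrt_sqr : csqrt ^+ 2 = cdiag ^+ 2 - coff ^+ 2.
Proof.
rewrite sqr_sqrtr; first by rewrite /cdiag /coff; field; rewrite gt_eqF.
by rewrite mulr_ge0 ?ltW// ltr_wpDr// divr_ge0// mulr_ge0 ?sqr_ge0// ltW.
Qed.

Lemma cdiag_gt0 : 0 < cdiag.
Proof. by rewrite /cdiag addr_gt0 ?invr_gt0// divr_gt0// mulr_gt0. Qed.

Let cds_gt0 : 0 < cdiag + csqrt.
Proof. by rewrite addr_gt0 ?cdiag_gt0// csqrt_gt0. Qed.

Lemma hq_eq : (cdiag + csqrt) * hq = - coff.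
Proof. by rewrite /hq mulrC divfK// gt_eqF. Qed.

Lemma hq_sqr : hq ^+ 2 = cratio.
Proof.
rewrite /hq /cratio expr_div_n sqrrN.
have -> : coff ^+ 2 = (cdiag - csqrt) * (cdiag + csqrt).
  by rewrite -subr_sqr csqrt_sqr; ring.
by rewrite expr2 -mulf_div divff ?mulr1// gt_eqF.
Qed.

Lemma cratio_ge0 : 0 <= cratio.
Proof. by rewrite -hq_sqr sqr_ge0. Qed.

Lemma cratio_lt1 : cratio < 1.
Proof. by rewrite /cratio ltr_pdivrMr// mul1r; have := csqrt_gt0; lra. Qed.

Lemma cratioN_lt1 : cratio ^+ N < 1.
Proof. by rewrite exprn_ilt1 ?cratio_ge0 ?cratio_lt1// -lt0n. Qed.

Lemma energy_gt0 : 0 < energy.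
Proof.
rewrite mulr_gt0 ?csqrt_gt0// divr_gt0 ?subr_gt0 ?cratioN_lt1//.
by rewrite ltr_wpDr ?ltr01 ?exprn_ge0 ?cratio_ge0.
Qed.

Let hq2N : hq ^+ N.*2 = cratio ^+ N.
Proof. by rewrite -mul2n exprM hq_sqr. Qed.

Let den_neq0 : 1 - cratio ^+ N != 0.
Proof. by rewrite gt_eqF// subr_gt0 cratioN_lt1. Qed.

Lemma harm0 : harm 0 = 1.
Proof. by rewrite /harm subn0 expr0 hq2N divff. Qed.

Lemma harmN : harm N = 0.
Proof. by rewrite /harm -addnn addnK subrr mul0r. Qed.

Let coff_hq : coff * (1 + hq ^+ 2) + 2 * cdiag * hq = 0.
Proof.
have e : coff = - (cdiag + csqrt) * hq by rewrite mulNr hq_eq opprK.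
have e2 : (cdiag + csqrt) * hq ^+ 2 = cdiag - csqrt.
  by rewrite hq_sqr /cratio mulrC divfK// gt_eqF.
rewrite {1}e; transitivity (hq * (- (cdiag + csqrt) * 1 - (cdiag + csqrt) * hq ^+ 2
   + 2 * cdiag)); first by ring.
by rewrite e2; ring.
Qed.

(** The discrete equation at node [n + 1], split into the contributions of its two cells so that
    sums over cells telescope. The bound on [n] keeps the truncated subtraction in [harm] exact. *)
Lemma harm_rec n : (n.+2 <= N.*2)%N ->
  coff * harm n + cdiag * harm n.+1 = - (cdiag * harm n.+1 + coff * harm n.+2).
Proof.
move=> nN; set m := (N.*2 - n.+2)%N.
have e1 : (N.*2 - n.+1 = m.+1)%N by rewrite /m; lia.
have e0 : (N.*2 - n = m.+2)%N by rewrite /m; lia.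
rewrite /harm e1 e0 -/m; apply/eqP; rewrite -subr_eq0; apply/eqP.
transitivity ((coff * (1 + hq ^+ 2) + 2 * cdiag * hq) * (hq ^+ n - hq ^+ m) /
  (1 - cratio ^+ N)); last by rewrite coff_hq !mul0r.
by rewrite !exprS; field.
Qed.

Lemma harm_energy : cdiag * harm 0 + coff * harm 1 = energy.
Proof.
have e : coff = - (cdiag + csqrt) * hq by rewrite mulNr hq_eq opprK.
have e2 : (cdiag + csqrt) * hq ^+ 2 = cdiag - csqrt.
  by rewrite hq_sqr /cratio mulrC divfK// gt_eqF.
rewrite harm0 /harm /energy expr1.
(* [hq ^ (2 N - 1)] occurs; naming its exponent gives [hq * hq ^ m = cratio ^ N] without dividing by
   [hq]. *)
have [m mE] : exists m, N.*2 = m.+1 by exists N.*2.-1; rewrite prednK// double_gt0.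
have := hq2N; rewrite mE subn1/= exprS => qm.
have -> : coff * ((hq - hq ^+ m) / (1 - cratio ^+ N)) =
    (- ((cdiag + csqrt) * hq ^+ 2) + (cdiag + csqrt) * (hq * hq ^+ m)) /
    (1 - cratio ^+ N) by rewrite {1}e; ring.
by rewrite qm e2; field.
Qed.

Definition cform (u u' v v' : R) : R :=
  cdiag * (u * v + u' * v') + coff * (u * v' + u' * v).

Lemma cform_swap u u' v v' : cform u' u v' v = cform u u' v v'.
Proof. by rewrite /cform; ring. Qed.

(** Summation by parts: harmonicity cancels the inner nodes, [V N = 0] the outer one, and the flux
    at the interface remains. *)
Lemma sum_cform_harm V : V N = 0 ->
  \sum_(i < N) cform (harm i) (harm i.+1) (V i) (V i.+1) = energy * V 0%N.
Proof.
move=> VN; pose H i := (cdiag * harm i + coff * harm i.+1) * V i.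
rewrite (eq_bigr (fun i : 'I_N => - H i.+1 - - H i)).
  rewrite -(big_mkord xpredT (fun i => - H i.+1 - - H i)).
  rewrite (telescope_sumr (fun i => - H i))//.
  by rewrite /H VN harm_energy mulr0; ring.
move=> i _; rewrite /cform /H.
case: (ltnP i.+1 N) => iN.
  have := @harm_rec i; rewrite -addnn => /(_ _)/esym.
  have -> : (i.+2 <= N + N)%N by lia.
  move=> /(_ isT) e.
  have -> : cdiag * harm i.+1 + coff * harm i.+2 = - (coff * harm i + cdiag * harm i.+1).
    by rewrite -e opprK.
  by ring.
have -> : V i.+1 = 0 by have -> : i.+1 = N by have := ltn_ord i; lia.
by ring.
Qed.

(** The stiffness square plus Simpson's rule for [lam u^2], which is exact for affine [u]. *)
Lemma cform_ge0 u u' : 0 <= cform u u' u u'.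
Proof.
have -> : cform u u' u u' = h^-1 * (u' - u) ^+ 2 +
   lam * h / 6 * (u ^+ 2 + u' ^+ 2 + (u + u') ^+ 2).
  by rewrite /cform /cdiag /coff; field; rewrite gt_eqF.
apply: addr_ge0; apply: mulr_ge0; rewrite ?invr_ge0 ?sqr_ge0 ?(ltW h0)//.
  by rewrite divr_ge0// mulr_ge0// ltW.
by rewrite !addr_ge0 ?sqr_ge0.
Qed.

Lemma cform_eq0 u u' : cform u u' u u' = 0 -> u = 0 /\ u' = 0.
Proof.
have -> : cform u u' u u' = h^-1 * (u' - u) ^+ 2 +
   lam * h / 6 * (u ^+ 2 + u' ^+ 2 + (u + u') ^+ 2).
  by rewrite /cform /cdiag /coff; field; rewrite gt_eqF.
have l0 : 0 < lam * h / 6 by rewrite divr_gt0// mulr_gt0.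
have i0 : 0 < h^-1 by rewrite invr_gt0.
move: l0 i0; move: (lam * h / 6) (h^-1) => l i l0 i0 e.
have s1 : 0 <= i * (u' - u) ^+ 2 by apply: mulr_ge0; [exact: ltW|exact: sqr_ge0].
have s2 : l * (u ^+ 2 + u' ^+ 2 + (u + u') ^+ 2) <= 0 by lra.
have s3 : u ^+ 2 + u' ^+ 2 + (u + u') ^+ 2 <= 0 by rewrite -(pmulr_rle0 _ l0).
have := sqr_ge0 u; have := sqr_ge0 u'; have := sqr_ge0 (u + u') => t1 t2 t3.
by split; apply/eqP; rewrite -sqrf_eq0 eq_le; apply/andP; split => //; lra.
Qed.

End DiscreteHarmonic.

(** * The one-dimensional form of a single frequency and its eigenvectors *)

Section ModeForm.
Context {R : realType}.
Variables (z : nat -> R) (Nm Np : nat) (hm hp : R).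
Hypotheses (hm0 : 0 < hm) (hp0 : 0 < hp) (Nm0 : (0 < Nm)%N) (Np0 : (0 < Np)%N).
Hypothesis zstep : forall i, z i.+1 - z i = if (i < Nm)%N then hm else hp.

Definition sig (sm sp : R) (i : nat) : R := if (i < Nm)%N then sm else sp.

Definition xform (lam sm sp : R) (U V : nat -> R) : R :=
  stiff z (Nm + Np) (sig sm sp) U V + lam * mass z (Nm + Np) (sig sm sp) U V.

Definition lform (lam : R) (U V : nat -> R) : R :=
  \sum_(i < Nm) cform hm lam (U i) (U i.+1) (V i) (V i.+1).
Definition rform (lam : R) (U V : nat -> R) : R :=
  \sum_(i < Np) cform hp lam (U (Nm + i)%N) (U (Nm + i).+1) (V (Nm + i)%N) (V (Nm + i).+1).

Lemma xformE lam sm sp U V :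
  xform lam sm sp U V = sm * lform lam U V + sp * rform lam U V.
Proof.
rewrite /xform /stiff /mass mulr_sumr -big_split/= big_split_ord/=.
rewrite /lform /rform !mulr_sumr; congr (_ + _); apply: eq_bigr => i _.
  rewrite /sig /slope zstep ltn_ord /cform /cdiag /coff; field.
  by rewrite gt_eqF.
rewrite /sig /slope zstep ltnNge leq_addr/= /cform /cdiag /coff; field.
by rewrite gt_eqF.
Qed.

Lemma xform_sym lam sm sp U V : xform lam sm sp U V = xform lam sm sp V U.
Proof.
rewrite !xformE /lform /rform; congr (_ * _ + _ * _); apply: eq_bigr => i _;
  by rewrite /cform; ring.
Qed.

Lemma cform_sum (h lam : R) (I : Type) (s : seq I) (c : I -> R) (u u' : I -> R) v v' :
  cform h lam (\sum_(k <- s) c k * u k) (\sum_(k <- s) c k * u' k) v v' =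
  \sum_(k <- s) c k * cform h lam (u k) (u' k) v v'.
Proof.
rewrite /cform !mulr_suml -!big_split/= !mulr_sumr -big_split/=.
by apply: eq_bigr => k _; ring.
Qed.

Lemma xform_sum lam sm sp (I : Type) (s : seq I) (c : I -> R) (U : I -> nat -> R) V :
  xform lam sm sp (fun i => \sum_(k <- s) c k * U k i) V =
  \sum_(k <- s) c k * xform lam sm sp (U k) V.
Proof.
rewrite xformE /lform /rform.
under eq_bigr do rewrite cform_sum.
under [X in _ + _ * X]eq_bigr do rewrite cform_sum.
rewrite exchange_big/= [X in _ + _ * X]exchange_big/= !mulr_sumr -big_split/=.
apply: eq_bigr => k _; rewrite xformE /lform /rform -!mulr_sumr; ring.
Qed.

Lemma xform_ge0 lam U : 0 < lam -> 0 <= xform lam 1 1 U U.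
Proof.
move=> l0; rewrite xformE !mul1r addr_ge0// /lform /rform sumr_ge0// => i _;
  exact: cform_ge0.
Qed.

Lemma xform_eq0 lam U : 0 < lam -> xform lam 1 1 U U = 0 ->
  forall i, (i <= Nm + Np)%N -> U i = 0.
Proof.
move=> l0; rewrite xformE !mul1r => e i iN.
have L0 : 0 <= lform lam U U by rewrite sumr_ge0// => j _; exact: cform_ge0.
have R0 : 0 <= rform lam U U by rewrite sumr_ge0// => j _; exact: cform_ge0.
have /eqP L1 : lform lam U U == 0 by rewrite eq_le L0 andbT; lra.
have /eqP R1 : rform lam U U == 0 by rewrite eq_le R0 andbT; lra.
have Lj (j : 'I_Nm) : U j = 0 /\ U j.+1 = 0.
  apply: (@cform_eq0 _ hm lam) => //; move/eqP: L1; rewrite psumr_eq0; last first.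
    by move=> k _; exact: cform_ge0.
  by move=> /allP/(_ j); rewrite mem_index_enum => /(_ isT)/eqP.
have Rj (j : 'I_Np) : U (Nm + j)%N = 0 /\ U (Nm + j).+1 = 0.
  apply: (@cform_eq0 _ hp lam) => //; move/eqP: R1; rewrite psumr_eq0; last first.
    by move=> k _; exact: cform_ge0.
  by move=> /allP/(_ j); rewrite mem_index_enum => /(_ isT)/eqP.
have [iNm|iNm] := ltnP i Nm; first exact: (Lj (Ordinal iNm)).1.
have [iNp|iNp] := ltnP (i - Nm) Np.
  by have := (Rj (Ordinal iNp)).1; rewrite /= subnKC.
(* The last node occurs only as the right end of a cell. *)
have iE : i = (Nm + Np.-1).+1 by lia.
have pN : (Np.-1 < Np)%N by lia.
by rewrite iE; exact: (Rj (Ordinal pN)).2.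
Qed.

(** Both halves are indexed by the distance to the interface node [Nm]. *)
Definition phi (lam : R) (i : nat) : R :=
  if (i <= Nm)%N then harm hm lam Nm (Nm - i) else harm hp lam Np (i - Nm).

Local Notation Em lam := (energy hm lam Nm).
Local Notation Ep lam := (energy hp lam Np).

Lemma phi_mid lam : 0 < lam -> phi lam Nm = 1.
Proof. by move=> l0; rewrite /phi leqnn subnn harm0. Qed.

Lemma phi0 lam : phi lam 0%N = 0.
Proof. by rewrite /phi /= subn0 harmN. Qed.

Lemma phiN lam : phi lam (Nm + Np)%N = 0.
Proof. by rewrite /phi ifN ?addKn ?harmN// -ltnNge -[X in (X < _)%N]addn0 ltn_add2l. Qed.

Lemma phi_right lam i : 0 < lam -> phi lam (Nm + i) = harm hp lam Np i.
Proof.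
move=> l0; rewrite /phi; case: leqP => [|_]; last by rewrite addKn.
rewrite -[X in (_ <= X)%N]addn0 leq_add2l leqn0 => /eqP ->.
by rewrite addn0 subnn !harm0.
Qed.

(** For all coefficients, [phi] tested with [V] sees only the interface value [V Nm]; comparing
    [sm, sp] with [1, 1] makes it an eigenvector. *)
Lemma xform_phi lam sm sp V : 0 < lam -> V 0%N = 0 -> V (Nm + Np)%N = 0 ->
  xform lam sm sp (phi lam) V = (sm * Em lam + sp * Ep lam) * V Nm.
Proof.
move=> l0 V0 VN; rewrite xformE mulrDl -(mulrA sm) -(mulrA sp); congr (_ * _ + _ * _).
  rewrite /lform (reindex_inj rev_ord_inj)/=.
  have H := sum_cform_harm hm0 l0 Nm0 (V := fun j => V (Nm - j)%N).
  rewrite /= subn0 subnn in H; rewrite -(H V0).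
  apply: eq_bigr => i _; have iN := ltn_ord i.
  rewrite /phi !ifT ?leq_subr//; last by lia.
  rewrite cform_swap.
  have -> : ((Nm - i.+1).+1 = Nm - i)%N by lia.
  have -> : (Nm - (Nm - i) = i)%N by lia.
  by have -> : (Nm - (Nm - i.+1) = i.+1)%N by lia.
have H := sum_cform_harm hp0 l0 Np0 (V := fun j => V (Nm + j)%N).
rewrite /= addn0 in H; rewrite -(H VN) /rform.
by apply: eq_bigr => i _; rewrite -!addnS !phi_right.
Qed.

(** Subtracting the harmonic part removes the value at the interface, so cutting there loses nothing
    and the two sides share no cell. *)
Definition vminus (lam : R) (V : nat -> R) (i : nat) : R :=
  if (i < Nm)%N then V i - V Nm * phi lam i else 0.
Definition vplus (lam : R) (V : nat -> R) (i : nat) : R :=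
  if (Nm < i)%N then V i - V Nm * phi lam i else 0.

Lemma vsplit lam V i : 0 < lam ->
  V i = V Nm * phi lam i + (vminus lam V i + vplus lam V i).
Proof.
move=> l0; rewrite /vminus /vplus; case: (ltngtP i Nm) => [||->].
- by rewrite addr0 addrC subrK.
- by rewrite add0r addrC subrK.
- by rewrite phi_mid// !addr0 mulr1.
Qed.

(** On the right all cells carry zeros, so the coefficient is constant on the support; [W] is
    arbitrary, as an eigenvector requires. *)
Lemma xform_vminus lam sm sp V W :
  xform lam sm sp (vminus lam V) W = sm * xform lam 1 1 (vminus lam V) W.
Proof.
rewrite !xformE !mul1r; suff -> : rform lam (vminus lam V) W = 0 by ring.
rewrite /rform big1// => i _; rewrite /vminus !ifN; [|lia|lia].
by rewrite /cform; ring.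
Qed.

Lemma xform_vplus lam sm sp V W :
  xform lam sm sp (vplus lam V) W = sp * xform lam 1 1 (vplus lam V) W.
Proof.
rewrite !xformE !mul1r; suff -> : lform lam (vplus lam V) W = 0 by ring.
rewrite /lform big1// => i _; have := ltn_ord i => iN.
by rewrite /vplus !ifN; [rewrite /cform; ring|lia|lia].
Qed.

Lemma xform_vminus_vplus lam V W : xform lam 1 1 (vminus lam V) (vplus lam W) = 0.
Proof.
rewrite xform_sym xformE !mul1r.
have -> : lform lam (vplus lam W) (vminus lam V) = 0.
  rewrite /lform big1// => i _; have := ltn_ord i => iN.
  by rewrite /vplus !ifN; [rewrite /cform; ring|lia|lia].
rewrite add0r /rform big1// => i _; rewrite /vminus !ifN; [|lia|lia].
by rewrite /cform; ring.
Qed.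

Lemma vminus_bd lam V : V 0%N = 0 -> [/\ vminus lam V 0%N = 0,
  vminus lam V (Nm + Np)%N = 0 & vminus lam V Nm = 0].
Proof.
move=> V0; rewrite /vminus Nm0 V0 phi0 mulr0 subrr ltnn ifN//; lia.
Qed.

Lemma vplus_bd lam V : V (Nm + Np)%N = 0 -> [/\ vplus lam V 0%N = 0,
  vplus lam V (Nm + Np)%N = 0 & vplus lam V Nm = 0].
Proof.
move=> VN; rewrite /vplus VN phiN mulr0 subrr ltnn; split=> //.
by rewrite if_same.
Qed.

End ModeForm.

(** * Operators with an orthogonal family of eigenvectors *)

Section SpectralBounds.
Context {R : realType}.
Variables (L sm sp : R) (X : set (R * R -> R)).
Local Notation ip := (H1_inner L).
Local Notation af := (a_form L sm sp).
Local Notation A := (riesz_op L sm sp X).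

(** Linearity over any [finType] yields differences at [bool] and multiples at [unit]; symmetry
    supplies the second argument. *)
Hypothesis X_sum : forall (I : finType) (c : I -> R) (e : I -> R * R -> R),
  (forall i, X (e i)) -> X (fun p => \sum_i c i * e i p).
Hypothesis ip_sum : forall (I : finType) (c : I -> R) (e : I -> R * R -> R) v,
  (forall i, X (e i)) -> X v -> ip (fun p => \sum_i c i * e i p) v = \sum_i c i * ip (e i) v.
Hypothesis af_sum : forall (I : finType) (c : I -> R) (e : I -> R * R -> R) v,
  (forall i, X (e i)) -> X v -> af (fun p => \sum_i c i * e i p) v = \sum_i c i * af (e i) v.
Hypothesis ip_sym : forall u v, X u -> X v -> ip u v = ip v u.
Hypothesis ip_ge0 : forall u, X u -> 0 <= ip u u.
Hypothesis ip_eq0 : forall u, X u -> ip u u = 0 -> u = fun=> 0.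

Definition eigenvector (mu : R) (e : R * R -> R) : Prop :=
  X e /\ forall v, X v -> af e v = mu * ip e v.

Let comb2 (u v : R * R -> R) (c : bool -> R) :
  (fun p => \sum_b c b * (if b then u else v) p) = (fun p => c true * u p + c false * v p).
Proof. by apply/funext => p; rewrite big_bool. Qed.

Let Xsub u v : X u -> X v -> X (fun p => u p - v p).
Proof.
move=> Xu Xv; have := X_sum (fun b : bool => if b then 1 else -1)
  (e := fun b : bool => if b then u else v).
rewrite comb2 => H; have {H} : X (fun p => 1 * u p + (-1) * v p) by apply: H => -[].
by congr X; apply/funext => p; rewrite mul1r mulN1r.
Qed.

Let sub_form f u v w :
  (forall (I : finType) (c : I -> R) (e : I -> R * R -> R) v,
     (forall i, X (e i)) -> X v -> f (fun p => \sum_i c i * e i p) v = \sum_i c i * f (e i) v) ->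
  X u -> X v -> X w -> f (fun p => u p - v p) w = f u w - f v w :> R.
Proof.
move=> f_sum Xu Xv Xw.
rewrite (_ : (fun p => _) = (fun p => \sum_(b : bool) (if b then 1 else -1) *
    (if b then u else v) p)).
  by rewrite f_sum// ?big_bool/= ?mul1r ?mulN1r// => -[].
by rewrite comb2; apply/funext => p; rewrite mul1r mulN1r.
Qed.

Let Xscale c u : X u -> X (fun p => c * u p).
Proof.
move=> Xu; have := X_sum (I := unit) (fun=> c) (e := fun=> u) (fun=> Xu).
congr X; apply/funext => p.
by rewrite (big_pred1 tt)// => -[].
Qed.

Let scale_form f c u w :
  (forall (I : finType) (c : I -> R) (e : I -> R * R -> R) v,
     (forall i, X (e i)) -> X v -> f (fun p => \sum_i c i * e i p) v = \sum_i c i * f (e i) v) ->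
  X u -> X w -> f (fun p => c * u p) w = c * f u w :> R.
Proof.
move=> f_sum Xu Xw.
rewrite (_ : (fun p => _) = (fun p => \sum_(b : unit) c * u p)).
  by rewrite (f_sum unit (fun=> c) (fun=> u))// (big_pred1 tt)// => -[].
by apply/funext => p; rewrite (big_pred1 tt)// => -[].
Qed.

(** The choice by [xget] is determined because two representers differ by an element of norm 0. *)
Lemma riesz_op_eq u f : X u -> X f -> (forall v, X v -> ip f v = af u v) -> A u = f.
Proof.
move=> Xu Xf fE; apply: xget_unique; first by split.
move=> g [Xg gE].
have Xd := Xsub Xg Xf.
have d0 : ip (fun p => g p - f p) (fun p => g p - f p) = 0.
  by rewrite (sub_form ip_sum)// gE// fE// subrr.
apply/funext => p; apply/eqP; rewrite -subr_eq0; apply/eqP.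
by have := congr1 (fun h => h p) (ip_eq0 Xd d0).
Qed.

Section Decomposition.
Variables (I : finType) (mu : I -> R) (beta : R).
Hypotheses (beta0 : 0 < beta) (mu_ge : forall i, beta <= `|mu i|).
(** The summands depend on [u]: eigenspaces enter as a whole, without a choice of basis. *)
Hypothesis eigen_dec : forall u, X u -> exists e : I -> R * R -> R,
  [/\ forall i, eigenvector (mu i) (e i), u = fun p => \sum_i e i p &
      forall i j, i != j -> ip (e i) (e j) = 0].

Let mu_neq0 i : mu i != 0.
Proof. by rewrite -normr_gt0 (lt_le_trans beta0). Qed.

Let sum1 (e : I -> R * R -> R) : (fun p => \sum_i e i p) = (fun p => \sum_i 1 * e i p).
Proof. by apply/funext => p; under [RHS]eq_bigr do rewrite mul1r. Qed.

Let A_inv e : (forall i, eigenvector (mu i) (e i)) ->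
  A (fun p => \sum_i (mu i)^-1 * e i p) = fun p => \sum_i e i p.
Proof.
move=> ev; have Xe i : X (e i) by have [] := ev i.
apply: riesz_op_eq; [exact: X_sum|by rewrite sum1; exact: X_sum|].
move=> v Xv; rewrite sum1 ip_sum// af_sum//; apply: eq_bigr => i _.
by rewrite (ev i).2// mulrA mulVf.
Qed.

Let A_dir e : (forall i, eigenvector (mu i) (e i)) ->
  A (fun p => \sum_i e i p) = fun p => \sum_i mu i * e i p.
Proof.
move=> ev; have Xe i : X (e i) by have [] := ev i.
apply: riesz_op_eq; [by rewrite sum1; exact: X_sum|exact: X_sum|].
move=> v Xv; rewrite sum1 ip_sum// af_sum//; apply: eq_bigr => i _.
by rewrite (ev i).2// mul1r.
Qed.

Let A_form u v : X u -> X v -> ip (A u) v = af u v.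
Proof.
move=> Xu Xv; have [e [ev -> _]] := eigen_dec Xu.
have Xe i : X (e i) by have [] := ev i.
rewrite (A_dir ev) [in RHS]sum1 ip_sum// af_sum//; apply: eq_bigr => i _.
by rewrite (ev i).2// mul1r.
Qed.

Lemma spectral_invertible : invertible_on X A.
Proof.
split.
- move=> u Xu /=; have [e [ev -> _]] := eigen_dec Xu.
  by rewrite (A_dir ev); apply: X_sum => i; have [] := ev i.
- move=> u u' /set_mem Xu /set_mem Xu' E.
  have Xd := Xsub Xu Xu'.
  have d0 v : X v -> af (fun p => u p - u' p) v = 0.
    by move=> Xv; rewrite (sub_form af_sum Xu Xu' Xv) -(A_form Xu Xv) -(A_form Xu' Xv) E subrr.
  clear E; have [e [ev dE orth]] := eigen_dec Xd.
  have Xe i : X (e i) by have [] := ev i.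
  have e0 i : e i = fun=> 0.
    apply: (ip_eq0 (Xe i)).
    (* Tested with its own component [e i], the difference leaves only [mu i * ip (e i) (e i)],
       which is therefore 0. *)
    have S : \sum_j 1 * af (e j) (e i) = mu i * ip (e i) (e i).
      rewrite (bigD1 i)//= big1 ?addr0 ?mul1r; first exact: ((ev i).2 _ (Xe i)).
      by move=> j ji; rewrite ((ev j).2 _ (Xe i)) (orth _ _ ji) !mulr0.
    apply/eqP; rewrite -(mulrI_eq0 _ (mulfI (mu_neq0 i))) -S; apply/eqP.
    by rewrite -(af_sum (fun=> 1) Xe (Xe i)) -(sum1 e) -dE; exact: (d0 _ (Xe i)).
  apply/funext => p; apply/eqP; rewrite -subr_eq0; apply/eqP.
  have -> : u p - u' p = \sum_i e i p := congr1 (fun h => h p) dE.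
  by rewrite big1// => i _; rewrite e0.
- move=> f Xf; have [e [ev -> _]] := eigen_dec Xf.
  exists (fun p => \sum_i (mu i)^-1 * e i p); last exact: A_inv.
  by apply: X_sum => i; have [] := ev i.
Qed.

(** The preimage of [f] divides each orthogonal component by its eigenvalue, so by Pythagoras the
    norm grows by a factor of at most [beta^-1]. *)
Lemma spectral_inv_norm : (inv_norm L X A <= (beta^-1)%:E)%E.
Proof.
rewrite /inv_norm; case: asboolP => [[_ Ainj _]|/(_ spectral_invertible)//].
apply: ge_ereal_sup => _ [f [Xf f1] <-]; rewrite lee_fin.
have [e [ev fE orth]] := eigen_dec Xf.
have Xe i : X (e i) by have [] := ev i.
pose u p := \sum_i (mu i)^-1 * e i p.
have Xu : X u by exact: X_sum.
have -> : 'pinv_(fun=> fun=> 0) X A f = u.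
  by rewrite fE -(A_inv ev) -/u pinvKV// inE.
have parseval (c : I -> R) : ip (fun p => \sum_i c i * e i p) (fun p => \sum_i c i * e i p) =
    \sum_i c i ^+ 2 * ip (e i) (e i).
  have Xc : X (fun p => \sum_i c i * e i p) by exact: X_sum.
  rewrite (ip_sum c Xe Xc); apply: eq_bigr => i _.
  rewrite (ip_sym (Xe i) Xc) (ip_sum c Xe (Xe i)).
  rewrite (bigD1 i)//= big1 ?addr0; first by rewrite mulrA expr2.
  by move=> j ji; rewrite orth// mulr0.
rewrite /H1_norm.
have fn : ip f f = \sum_i ip (e i) (e i).
  by rewrite fE sum1 parseval; apply: eq_bigr => i _; rewrite expr1n mul1r.
have f2 : ip f f <= 1.
  by move: f1; rewrite /H1_norm -[X in _ <= X]sqrtr1 ler_sqrt// ltr01.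
have -> : beta^-1 = Num.sqrt (beta^-1 ^+ 2) by rewrite sqrtr_sqr ger0_norm// invr_ge0 ltW.
apply: ler_wsqrtr.
rewrite /u parseval; apply: (@le_trans _ _ (beta^-1 ^+ 2 * ip f f)); last first.
  by rewrite ger_pMr// exprn_gt0// invr_gt0.
rewrite fn mulr_sumr; apply: ler_sum => i _; apply: ler_wpM2r; first exact: ip_ge0.
rewrite -real_normK ?num_real// normfV lerXn2r ?nnegrE ?invr_ge0 ?(ltW beta0)//.
by rewrite lef_pV2 ?posrE ?normr_gt0.
Qed.

End Decomposition.

(** Without invertibility the norm is +oo by convention; otherwise the inverse maps the normalized
    eigenvector to one of norm [|mu|^-1]. *)
Lemma eigenvalue_inv_norm mu e C : 0 < C -> eigenvector mu e -> ip e e != 0 ->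
  `|mu| * C <= 1 -> (C%:E <= inv_norm L X A)%E.
Proof.
move=> C0 [Xe ev] e0 muC; rewrite /inv_norm.
case: asboolP => [[_ Ainj _]|_]; last by rewrite leey.
have Ac c : A (fun p => c * e p) = fun p => c * mu * e p.
  apply: riesz_op_eq; [exact: Xscale|exact: Xscale|].
  move=> v Xv; rewrite (scale_form _ ip_sum)// (scale_form _ af_sum)// ev//.
  by rewrite mulrA.
have ne0 : 0 < ip e e by rewrite lt_neqAle eq_sym e0 ip_ge0.
(* For [mu = 0] the operator would send both [e] and 0 to 0. *)
have mu0 : mu != 0.
  apply/eqP => mu0; have := Ainj (fun p => 1 * e p) (fun p => 0 * e p).
  rewrite !inE !Ac mu0 !mulr0 => /(_ (Xscale 1 Xe) (Xscale 0 Xe) erefl) E.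
  move/eqP: e0; apply.
  have -> : e = fun p => 0 * e p.
    by rewrite -E; apply/funext => p; rewrite mul1r.
  by rewrite (scale_form _ ip_sum) ?mul0r//; exact: Xscale.
pose s := Num.sqrt (ip e e).
have s0 : 0 < s by rewrite sqrtr_gt0.
have nc c : H1_norm L (fun p => c * e p) = `|c| * s.
  rewrite /H1_norm (scale_form _ ip_sum)//; last exact: Xscale.
  rewrite ip_sym//; last exact: Xscale.
  by rewrite (scale_form _ ip_sum)// mulrA -expr2 sqrtrM ?sqr_ge0// sqrtr_sqr.
apply: le_ereal_sup_tmp; exists ((H1_norm L (fun p => (mu * s)^-1 * e p))%:E); last first.
  rewrite lee_fin nc normfV normrM (gtr0_norm s0) invfM -mulrA mulVf ?gt_eqF// mulr1.
  by rewrite -div1r ler_pdivlMr ?normr_gt0// mulrC.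
exists (fun p => s^-1 * e p).
  by split; [exact: Xscale|rewrite nc normfV gtr0_norm// mulVf// gt_eqF].
congr (H1_norm L _)%:E.
have -> : (fun p => s^-1 * e p) = A (fun p => (mu * s)^-1 * e p).
  rewrite Ac; apply/funext => p; clearbody s; field.
  by rewrite mu0 gt_eqF.
by rewrite pinvKV// inE; exact: Xscale.
Qed.

End SpectralBounds.

(** * The spectrum of the discrete operator *)

Section DiscreteOperator.
Context {R : realType}.
Variables (L sm sp : R) (Nm Np M : nat).
Hypotheses (L0 : 0 < L) (Nm0 : (0 < Nm)%N) (Np0 : (0 < Np)%N) (M0 : (0 < M)%N).

Local Notation n := (Nm + Np)%N.
Local Notation hm := (h_minus L Nm).
Local Notation hp := (h_plus L Np).
Local Notation y := (@ymesh R M).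
Local Notation K := (M.-1).
Local Notation lam k := (@ylambda R M k).

(** The signed node numbers shifted to start at 0, with the interface at [Nm]; the sequence runs on
    beyond [L] and so increases at every index. *)
Definition xmesh (i : nat) : R := node L Nm Np (i%:Z - Nm%:Z).

Lemma hm_gt0 : 0 < hm. Proof. by rewrite divr_gt0// ltr0n. Qed.
Lemma hp_gt0 : 0 < hp. Proof. by rewrite divr_gt0// ltr0n. Qed.

Lemma xmesh_left i : (i <= Nm)%N -> xmesh i = hm * (i%:R - Nm%:R).
Proof.
move=> iN; rewrite /xmesh /node; case: ifPn => i0.
  have -> : i = Nm by lia.
  by rewrite !subrr !mulr0.
by rewrite intrB.
Qed.

Lemma xmesh_right i : (Nm <= i)%N -> xmesh i = hp * (i%:R - Nm%:R).
Proof. by move=> iN; rewrite /xmesh /node ifT ?intrB//; lia. Qed.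

Lemma xmesh_step i : xmesh i.+1 - xmesh i = if (i < Nm)%N then hm else hp.
Proof.
case: ifPn => iN; last rewrite -leqNgt in iN.
  rewrite !xmesh_left//; last exact: ltnW.
  by rewrite -natr1; ring.
rewrite !xmesh_right//; last exact: leqW.
by rewrite -natr1; ring.
Qed.

Lemma xmesh_lt i : xmesh i < xmesh i.+1.
Proof. by rewrite -subr_gt0 xmesh_step; case: ifP; rewrite ?hm_gt0 ?hp_gt0. Qed.

Lemma xmesh0 : xmesh 0%N = - L.
Proof. by rewrite xmesh_left// sub0r mulrN /h_minus divfK// pnatr_eq0 -lt0n. Qed.

Lemma xmeshN : xmesh n = L.
Proof.
rewrite xmesh_right ?leq_addr// natrD [_ + Np%:R]addrC addrK /h_plus divfK//.
by rewrite pnatr_eq0 -lt0n.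
Qed.

Lemma ymesh0 : y 0%N = 0. Proof. by rewrite /ymesh mulr0. Qed.
Lemma ymeshM : y M = pi. Proof. by rewrite /ymesh divfK// pnatr_eq0 -lt0n. Qed.

Let xlt := xmesh_lt.
Let ylt : forall j, y j < y j.+1 := ymesh_lt M0.

Lemma pl_V_h U : U 0%N = 0 -> U n = 0 -> V_h L Nm Np (pl xmesh n U).
Proof.
move=> U0 Un; split; first by rewrite -{1}xmesh0 -xmeshN; exact: pl_H10.
move=> k kN; pose i : nat := absz (k + Nm%:Z).
have kE : k = i%:Z - Nm%:Z by rewrite /i; lia.
have -> : node L Nm Np k = xmesh i by rewrite kE.
have -> : node L Nm Np (k + 1) = xmesh i.+1 by rewrite kE /xmesh; congr node; lia.
by apply: pl_affine => //; lia.
Qed.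

Lemma V_h_pl v : V_h L Nm Np v ->
  [/\ v = pl xmesh n (v \o xmesh), v (xmesh 0%N) = 0 & v (xmesh n) = 0].
Proof.
move=> [Hv aff]; suff H i : (i < n)%N -> affine_on `]xmesh i, xmesh i.+1[ v.
  rewrite -[X in H10 X]xmesh0 -[X in H10 _ X]xmeshN in Hv.
  have n0 : (0 < n)%N by rewrite addn_gt0 Nm0.
  by have [vE [v0 vn]] := H10_pl xlt n0 Hv H.
move=> iN; have := aff (i%:Z - Nm%:Z); rewrite -/(xmesh i).
have -> : node L Nm Np (i%:Z - Nm%:Z + 1) = xmesh i.+1 by rewrite /xmesh; congr node; lia.
by apply; lia.
Qed.

Lemma pl_W_h W : W 0%N = 0 -> W M = 0 -> W_h M (pl y M W).
Proof.
move=> W0 WM; split.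
  by rewrite -[X in H10 X]ymesh0 -[X in H10 _ X]ymeshM; exact: pl_H10.
move=> j jM; exact: (pl_affine ylt).
Qed.

Lemma W_h_pl w : W_h M w ->
  [/\ w = pl y M (w \o y), w (y 0%N) = 0 & w (y M) = 0].
Proof.
move=> [Hw aff]; rewrite -[X in H10 X]ymesh0 -[X in H10 _ X]ymeshM in Hw.
by have [wE [w0 wn]] := H10_pl ylt M0 Hw aff.
Qed.

(** Coordinates of the discrete space: nodal values in [x] for each of the [M - 1] sines in [y]. *)
Definition TP (V : 'I_K -> nat -> R) : R * R -> R :=
  tp xmesh y n M V (fun k : 'I_K => sn M k).

Definition nodal (V : 'I_K -> nat -> R) : Prop := forall k, V k 0%N = 0 /\ V k n = 0.

Lemma pl_ext (z : nat -> R) m U U' x : (forall j, (j <= m)%N -> U j = U' j) ->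
  pl z m U x = pl z m U' x.
Proof.
move=> UU; apply: eq_bigr => i _; have iM := ltn_ord i.
by rewrite /slope !UU// ltnW.
Qed.

(** The [y] factor of each tensor is expanded in sines by [sn_complete], and the coefficients move
    to the [x] factor. *)
Lemma X_hP u : X_h L Nm Np M u <-> exists2 V, nodal V & u = TP V.
Proof.
split=> [[m [c [v [w [vw ->]]]]]|[V Vn ->]].
  pose b i (k : 'I_K) := 2 / M%:R * \sum_(j < M) w i (y j) * sn M k j.
  exists (fun k j => \sum_(i < m) (c i * b i k) * v i (xmesh j)).
    move=> k; split; rewrite big1// => i _; have [/V_h_pl[_ v0 vn] _] := vw i.
      by rewrite v0 mulr0.
    by rewrite vn mulr0.
  apply/funext => -[p q]; rewrite /TP /tp/=.
  under [RHS]eq_bigr do rewrite pl_sum mulr_suml.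
  rewrite exchange_big/=; apply: eq_bigr => i _.
  have [/V_h_pl[vE _ _] /W_h_pl[wE w0 wM]] := vw i.
  rewrite {1}vE {1}wE.
  rewrite [X in _ * (_ * X)](@pl_ext y M _ (fun j => \sum_(k < K) b i k * sn M k j));
    last by move=> j jM; rewrite (sn_complete M0 (W := w i \o y)).
  rewrite pl_sum !mulr_sumr; apply: eq_bigr => k _.
  rewrite -[pl _ _ (v i \o xmesh) p]/(pl xmesh n (fun j => v i (xmesh j)) p); ring.
exists K, (fun=> 1), (fun k => pl xmesh n (V k)), (fun k => pl y M (sn M k)); split.
  move=> k; have [V0 VN] := Vn k.
  by split; [exact: pl_V_h|apply: pl_W_h; rewrite ?sn0 ?snM].
by apply/funext => p; apply: eq_bigr => k _; rewrite mul1r.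
Qed.

Lemma TP_sum (I : finType) (c : I -> R) (V : I -> 'I_K -> nat -> R) :
  TP (fun k j => \sum_i c i * V i k j) = fun p => \sum_i c i * TP (V i) p.
Proof.
apply/funext => p; rewrite /TP /tp.
under eq_bigr do rewrite pl_sum mulr_suml.
rewrite exchange_big/=; apply: eq_bigr => i _.
by rewrite mulr_sumr; apply: eq_bigr => k _; rewrite mulrA.
Qed.

Local Notation xf := (xform xmesh Nm Np).
Local Notation ip := (H1_inner L).
Local Notation af := (a_form L sm sp).

(** Sine orthogonality leaves the diagonal [k = l], where the stiffness in [y] is [lam] times the
    mass, so both terms merge into one form. *)
Let form_TP (a b : R) V V' :
  \sum_(k < K) \sum_(l < K)
    (stiff xmesh n (sig Nm a b) (V k) (V' l) * mass y M (fun=> 1) (sn M k) (sn M l) +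
     mass xmesh n (sig Nm a b) (V k) (V' l) * stiff y M (fun=> 1) (sn M k) (sn M l)) =
  \sum_(k < K) ymass M k * xf (lam k) a b (V k) (V' k).
Proof.
apply: eq_bigr => k _; rewrite (bigD1 k)//= big1 ?addr0.
  by rewrite mass_snsn// stiff_snsn// eqxx /xform; ring.
by move=> l lk; rewrite mass_snsn// stiff_snsn// eq_sym (negPf lk) !mulr0 addr0.
Qed.

Lemma H1_TP V V' :
  ip (TP V) (TP V') = \sum_(k < K) ymass M k * xf (lam k) 1 1 (V k) (V' k).
Proof.
rewrite -form_TP.
rewrite -(integral_grad (S := fun=> 1) (s := sig Nm 1 1) M xlt ylt).
  rewrite xmesh0 xmeshN ymesh0 ymeshM /H1_inner; apply: eq_Rintegral => p _.
  by rewrite mul1r.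
by move=> i x _; rewrite /sig if_same.
Qed.

Lemma a_TP V V' :
  af (TP V) (TP V') = \sum_(k < K) ymass M k * xf (lam k) sm sp (V k) (V' k).
Proof.
rewrite -form_TP.
rewrite -(integral_grad (S := sigma sm sp) (s := sig Nm sm sp) M xlt ylt).
  by rewrite xmesh0 xmeshN ymesh0 ymeshM.
move=> i x /andP[ix xi]; rewrite /sigma /sig.
(* The interface is a node and cells are closed on the left, so [sigma] is constant on each cell,
   with value [sp] at 0. *)
have xN : xmesh Nm = 0 by rewrite xmesh_left// subrr mulr0.
case: (ltnP i Nm) => iN.
  rewrite ifT//; apply: (lt_le_trans xi); rewrite -xN; exact: (mesh_le xlt).
rewrite ifF//; apply/negbTE; rewrite -leNgt; apply: le_trans ix; rewrite -xN.
exact: (mesh_le xlt).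
Qed.

Let lam_gt0 (k : 'I_K) : 0 < lam k := ylambda_gt0 M0 k.
Let step := xmesh_step.

Local Notation X := (X_h L Nm Np M).

Let X_sum (I : finType) (c : I -> R) (e : I -> R * R -> R) :
  (forall i, X (e i)) -> X (fun p => \sum_i c i * e i p).
Proof.
move=> Xe; have /choice[V HV] : forall i, exists V, nodal V /\ e i = TP V.
  by move=> i; have /X_hP[V Vn ->] := Xe i; exists V.
apply/X_hP; exists (fun k j => \sum_i c i * V i k j).
  by move=> k; split; rewrite big1// => i _; have [/(_ k)[V0 VN] _] := HV i;
    rewrite ?V0 ?VN mulr0.
by rewrite TP_sum; apply/funext => p; apply: eq_bigr => i _; rewrite (HV i).2.
Qed.

Let form_sum f (a b : R) :
  (forall V V', f (TP V) (TP V') =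
     \sum_(k < K) ymass M k * xf (lam k) a b (V k) (V' k)) ->
  forall (I : finType) (c : I -> R) (e : I -> R * R -> R) v,
  (forall i, X (e i)) -> X v -> f (fun p => \sum_i c i * e i p) v = \sum_i c i * f (e i) v.
Proof.
move=> fE I c e v Xe /X_hP[W _ ->].
have /choice[V HV] : forall i, exists V, e i = TP V.
  by move=> i; have /X_hP[V Vn ->] := Xe i; exists V.
have -> : (fun p => \sum_i c i * e i p) = TP (fun k j => \sum_i c i * V i k j).
  by rewrite TP_sum; apply/funext => p; apply: eq_bigr => i _; rewrite HV.
rewrite fE; under eq_bigr do rewrite (xform_sum Np hm_gt0 hp_gt0 step) mulr_sumr.
rewrite exchange_big/=; apply: eq_bigr => i _; rewrite HV fE mulr_sumr.
by apply: eq_bigr => k _; ring.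
Qed.

Let ip_sym u v : X u -> X v -> ip u v = ip v u.
Proof.
move=> /X_hP[V _ ->] /X_hP[W _ ->]; rewrite !H1_TP; apply: eq_bigr => k _.
by rewrite (xform_sym Np hm_gt0 hp_gt0 step).
Qed.

Let term_ge0 V (k : 'I_K) : 0 <= ymass M k * xf (lam k) 1 1 (V k) (V k).
Proof.
by rewrite mulr_ge0 ?(ltW (ymass_gt0 M0 k))// (xform_ge0 Np hm_gt0 hp_gt0 step).
Qed.

Let ip_ge0 u : X u -> 0 <= ip u u.
Proof. by move=> /X_hP[V _ ->]; rewrite H1_TP sumr_ge0. Qed.

Let ip_eq0 u : X u -> ip u u = 0 -> u = fun=> 0.
Proof.
move=> /X_hP[V Vn ->]; rewrite H1_TP => /eqP; rewrite psumr_eq0// => /allP V0.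
have {}V0 k j : (j <= n)%N -> V k j = 0.
  apply: (xform_eq0 hm_gt0 hp_gt0 Nm0 Np0 step (lam_gt0 k)).
  have := V0 k; rewrite mem_index_enum => /(_ isT).
  by rewrite mulf_eq0 gt_eqF ?ymass_gt0//= => /eqP.
apply/funext => p; rewrite /TP /tp big1// => k _.
rewrite (@pl_ext xmesh n (V k) (fun=> 0)); last by move=> j jn; rewrite V0.
rewrite [pl _ _ _ _]big1 ?mul0r// => i _.
by rewrite /slope subrr !mul0r addr0 mul0r.
Qed.

Definition mode_eigenvalue (k : nat) : R :=
  (sm * energy hm (lam k) Nm + sp * energy hp (lam k) Np) /
  (energy hm (lam k) Nm + energy hp (lam k) Np).

Let E_gt0 (k : 'I_K) : 0 < energy hm (lam k) Nm + energy hp (lam k) Np.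
Proof. by rewrite addr_gt0 ?energy_gt0 ?hm_gt0 ?hp_gt0. Qed.

Definition phimode (c : 'I_K -> R) (k : 'I_K) : 'I_K -> nat -> R :=
  fun l i => if l == k then c k * phi Nm Np hm hp (lam k) i else 0.

Let xf_scale (l a b c : R) U V : xf l a b (fun i => c * U i) V = c * xf l a b U V.
Proof.
have := xform_sum Np hm_gt0 hp_gt0 step l a b [:: tt] (fun=> c) (fun=> U) V.
rewrite big_seq1 => <-; congr xf.
by apply/funext => i; rewrite big_seq1.
Qed.

Let xf0 (l a b : R) V : xf l a b (fun=> 0) V = 0.
Proof.
rewrite -[RHS](mul0r (xf l a b (fun=> 0) V)) -xf_scale; congr xf.
by apply/funext => i; rewrite mulr0.
Qed.

Let phimode_form (a b : R) c k W : nodal W ->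
  \sum_(l < K) ymass M l * xf (lam l) a b (phimode c k l) (W l) =
  ymass M k * (c k * ((a * energy hm (lam k) Nm + b * energy hp (lam k) Np) * W k Nm)).
Proof.
move=> Wn; rewrite (bigD1 k)//= big1 ?addr0.
  rewrite /phimode eqxx xf_scale (xform_phi hm_gt0 hp_gt0 Nm0 Np0 step)//.
    by have [] := Wn k.
  by have [] := Wn k.
by move=> l lk; rewrite /phimode (negPf lk) xf0 mulr0.
Qed.

Let phimode_nodal c k : nodal (phimode c k).
Proof.
by move=> l; rewrite /phimode; case: ifP => // _;
  rewrite phi0 (phiN _ _ _ Np0) mulr0.
Qed.

Lemma phimode_eigenvector c (k : 'I_K) :
  eigenvector L sm sp X (mode_eigenvalue k) (TP (phimode c k)).
Proof.
split; first by apply/X_hP; exists (phimode c k).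
move=> v /X_hP[W Wn ->]; rewrite a_TP H1_TP !phimode_form// /mode_eigenvalue.
have := E_gt0 k; move: (energy _ _ _) (energy _ _ _) => E1 E2 E0.
by field; rewrite gt_eqF.
Qed.

Let side (b : bool) (V : 'I_K -> nat -> R) : 'I_K -> nat -> R := fun k =>
  if b then vminus Nm Np hm hp (lam k) (V k) else vplus Nm Np hm hp (lam k) (V k).

Let side_nodal b V : nodal V -> nodal (side b V) /\ forall k, side b V k Nm = 0.
Proof.
move=> Vn; split=> k; have [V0 VN] := Vn k.
  by case: b; rewrite /side; [have [] := vminus_bd hm_gt0 hp_gt0 Nm0 Np0 (lam k) V0|
    have [] := vplus_bd hm hp Np0 (lam k) VN].
by case: b; rewrite /side; [have [] := vminus_bd hm_gt0 hp_gt0 Nm0 Np0 (lam k) V0|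
    have [] := vplus_bd hm hp Np0 (lam k) VN].
Qed.

Let side_eigenvector b V : nodal V ->
  eigenvector L sm sp X (if b then sm else sp) (TP (side b V)).
Proof.
move=> Vn; split.
  by apply/X_hP; exists (side b V) => //; exact: (side_nodal b Vn).1.
move=> v /X_hP[W Wn ->]; rewrite a_TP H1_TP mulr_sumr; apply: eq_bigr => k _.
rewrite mulrCA; congr (_ * _); case: b; rewrite /side.
  exact: (xform_vminus hm_gt0 hp_gt0 Nm0 Np0 step).
exact: (xform_vplus hm_gt0 hp_gt0 Nm0 Np0 step).
Qed.

(** One index per frequency for the harmonic modes, but a single one per side, where all frequencies
    share the eigenvalue. *)
Definition spectrum (i : 'I_K + bool) : R :=
  match i with inl k => mode_eigenvalue k | inr b => if b then sm else sp end.

Let component (V : 'I_K -> nat -> R) (i : 'I_K + bool) : R * R -> R :=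
  match i with
  | inl k => TP (phimode (fun k => V k Nm) k)
  | inr b => TP (side b V)
  end.

Let component_sum V : TP V = fun p => \sum_i component V i p.
Proof.
have comp1 : (fun p => \sum_i component V i p) =
    TP (fun k j => \sum_i 1 * (match i with
      | inl l => phimode (fun k => V k Nm) l | inr b => side b V end) k j).
  rewrite TP_sum; apply/funext => p; apply: eq_bigr => -[k|b] _; exact/esym/mul1r.
rewrite comp1; congr TP; apply/funext => k; apply/funext => j.
rewrite big_sumType big_bool/= (bigD1 k)//= big1; last first.
  by move=> l lk; rewrite /phimode eq_sym (negPf lk) mulr0.
rewrite /phimode eqxx addr0 !mul1r /side.
exact: (vsplit Np hp hm_gt0 Nm0).
Qed.

(** A harmonic mode sees only the interface value at its own frequency, which is 0 for one-sided
    parts and for other modes. *)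
Let component_orth V : nodal V -> forall i j, i != j ->
  ip (component V i) (component V j) = 0.
Proof.
move=> Vn.
have Ek (k l : 'I_K) : k != l ->
    ip (component V (inl k)) (component V (inl l)) = 0.
  move=> kl; rewrite /= H1_TP phimode_form; last exact: phimode_nodal.
  by rewrite /phimode (negPf kl) !mulr0.
have Es k b : ip (component V (inl k)) (component V (inr b)) = 0.
  have [sn' s0] := side_nodal b Vn.
  by rewrite /= H1_TP phimode_form// s0 !mulr0.
have Es' k b : ip (component V (inr b)) (component V (inl k)) = 0.
  rewrite ip_sym ?Es//; apply/X_hP.
    by exists (side b V) => //; exact: (side_nodal b Vn).1.
  by exists (phimode (fun k => V k Nm) k).
have Ebb : ip (component V (inr true)) (component V (inr false)) = 0.
  rewrite /= H1_TP big1// => k _.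
  by rewrite /side (xform_vminus_vplus hm_gt0 hp_gt0 Nm0 Np0 step) mulr0.
have Ebb' : ip (component V (inr false)) (component V (inr true)) = 0.
  by rewrite ip_sym ?Ebb//; apply/X_hP; [exists (side false V)|exists (side true V)] => //;
    exact: (side_nodal _ Vn).1.
case=> [k|b] [l|b'] ij; [exact: (Ek k l ij)|exact: Es|exact: Es'|].
move: b b' ij => [] [] ij; [by case/eqP: ij|exact: Ebb|exact: Ebb'|by case/eqP: ij].
Qed.

Let eigen_dec u : X u -> exists e : 'I_K + bool -> R * R -> R,
  [/\ forall i, eigenvector L sm sp X (spectrum i) (e i), u = fun p => \sum_i e i p &
      forall i j, i != j -> ip (e i) (e j) = 0].
Proof.
move=> /X_hP[V Vn ->]; exists (component V); split.
- move=> [k|b]; [exact: phimode_eigenvector|exact: side_eigenvector].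
- exact: component_sum.
- exact: component_orth.
Qed.

Lemma A_h_upper (beta : R) : 0 < beta -> beta <= `|sm| -> beta <= `|sp| ->
  (forall k : 'I_K, beta <= `|mode_eigenvalue k|) ->
  invertible_on X (A_h L sm sp Nm Np M) /\
  (inv_norm L X (A_h L sm sp Nm Np M) <= (beta^-1)%:E)%E.
Proof.
move=> b0 bm bp bk.
have mu_ge i : beta <= `|spectrum i| by case: i => [k|[]] /=.
have ips := form_sum H1_TP; have afs := form_sum a_TP.
split; first exact: (spectral_invertible X_sum ips afs ip_eq0 b0 mu_ge eigen_dec).
exact: (spectral_inv_norm X_sum ips afs ip_sym ip_ge0 ip_eq0 b0 mu_ge eigen_dec).
Qed.

Lemma A_h_lower (k : 'I_K) (C : R) : 0 < C -> `|mode_eigenvalue k| * C <= 1 ->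
  (C%:E <= inv_norm L X (A_h L sm sp Nm Np M))%E.
Proof.
move=> C0 kC.
apply: (eigenvalue_inv_norm X_sum (form_sum H1_TP) (form_sum a_TP) ip_sym ip_ge0
  ip_eq0 C0 (phimode_eigenvector (fun=> 1) k) _ kC).
rewrite H1_TP phimode_form; last exact: phimode_nodal.
rewrite /phimode eqxx !mul1r (phi_mid Np hp hm_gt0 Nm0)// mulr1.
by rewrite mulf_neq0// ?gt_eqF ?ymass_gt0.
Qed.

End DiscreteOperator.

(** * Influence of the outer boundary *)

Section Decay.
Context {R : realType}.

Lemma expRN_le (y : R) : 0 <= y -> expR (- y) <= (1 + y)^-1.
Proof.
move=> y0; rewrite expRN lef_pV2 ?posrE ?expR_gt0 ?expR_ge1Dx//.
by rewrite ltr_wpDr.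
Qed.

Section OneSide.
Variables (h lam : R).
Hypotheses (h0 : 0 < h) (lam0 : 0 < lam).

Let z := Num.sqrt lam * h.
(** Chosen so that [cratio = (1 - t) / (1 + t)]; for small [z] it equals [z] to leading order. *)
Let t := csqrt h lam / cdiag h lam.

Let z0 : 0 < z. Proof. by rewrite mulr_gt0// sqrtr_gt0. Qed.

Let z2 : z ^+ 2 = lam * h ^+ 2.
Proof. by rewrite exprMn sqr_sqrtr// ltW. Qed.

Let cdiagE : cdiag h lam = (1 + z ^+ 2 / 3) / h.
Proof. by rewrite z2 /cdiag; field; rewrite gt_eqF. Qed.

Let csqrtE : csqrt h lam = Num.sqrt lam * Num.sqrt (1 + z ^+ 2 / 12).
Proof. by rewrite /csqrt sqrtrM ?ltW// z2. Qed.

Lemma cratioE : cratio h lam = (1 - t) / (1 + t).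
Proof.
have c0 := cdiag_gt0 h0 lam0; have s0 := csqrt_gt0 h lam0.
rewrite /cratio /t; move: (cdiag _ _) (csqrt _ _) c0 s0 => a s a0 s0; field.
by rewrite !gt_eqF ?addr_gt0.
Qed.

Let w0 : 0 < 1 + z ^+ 2 / 3.
Proof. by rewrite ltr_wpDr// divr_ge0// sqr_ge0. Qed.

Lemma decay_upper : t <= z.
Proof.
rewrite /t ler_pdivrMr ?cdiag_gt0// cdiagE csqrtE /z.
have -> : Num.sqrt lam * h * ((1 + z ^+ 2 / 3) / h) = Num.sqrt lam * (1 + z ^+ 2 / 3).
  by field; rewrite gt_eqF.
rewrite ler_pM2l ?sqrtr_gt0//.
rewrite -[leRHS]ger0_norm ?(ltW w0)// -sqrtr_sqr; apply: ler_wsqrtr.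
by rewrite -/z; move: (z ^+ 2) (sqr_ge0 z) => q q0; nra.
Qed.

Lemma decay_lower : z / (1 + z ^+ 2 / 3) <= t.
Proof.
rewrite /t ler_pdivlMr ?cdiag_gt0// cdiagE csqrtE /z.
have -> : Num.sqrt lam * h / (1 + z ^+ 2 / 3) * ((1 + z ^+ 2 / 3) / h) = Num.sqrt lam.
  by move: (1 + _) w0 => w w0'; field; rewrite !gt_eqF.
rewrite -[leLHS]mulr1 ler_pM2l ?sqrtr_gt0// -[leLHS]sqrtr1; apply: ler_wsqrtr.
by rewrite lerDl divr_ge0// sqr_ge0.
Qed.

Lemma decay_gt0 : 0 < t.
Proof. by rewrite divr_gt0 ?csqrt_gt0 ?cdiag_gt0. Qed.

Lemma decay_le1 : t <= 1.
Proof.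
rewrite /t ler_pdivrMr ?cdiag_gt0// mul1r.
have c0 := cdiag_gt0 h0 lam0; have s0 := csqrt_gt0 h lam0.
have := csqrt_sqr h0 lam0; have := sqr_ge0 (coff h lam); nra.
Qed.

(** [(1 - t) / (1 + t) = 1 - 2 t / (1 + t)] and [1 + x <= exp x]. *)
Lemma cratio_exp_le N : cratio h lam ^+ N <= expR (- (2 * (t * N%:R) / (1 + t))).
Proof.
have t0 := decay_gt0.
have -> : - (2 * (t * N%:R) / (1 + t)) = - (2 * t / (1 + t)) * N%:R by ring.
rewrite expRM_natr lerXn2r ?nnegrE ?expR_ge0 ?cratio_ge0//.
apply: le_trans (expR_ge1Dx _); rewrite cratioE.
by rewrite [leRHS](_ : _ = (1 - t) / (1 + t))//; field; rewrite gt_eqF ?addr_gt0.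
Qed.

(** The same inequality for the reciprocal [1 + 2 t / (1 - t)]. *)
Lemma cratio_exp_ge N : t < 1 -> expR (- (2 * (t * N%:R) / (1 - t))) <= cratio h lam ^+ N.
Proof.
move=> t1; have t0 := decay_gt0.
have -> : - (2 * (t * N%:R) / (1 - t)) = - (2 * t / (1 - t)) * N%:R by ring.
rewrite expRM_natr lerXn2r ?nnegrE ?expR_ge0 ?cratio_ge0//.
rewrite expRN cratioE -[leRHS]invrK lef_pV2 ?posrE ?expR_gt0//; last first.
  by rewrite invr_gt0 divr_gt0// ?subr_gt0// addr_gt0.
apply: le_trans (expR_ge1Dx _).
rewrite [leRHS](_ : _ = ((1 - t) / (1 + t))^-1)//; field.
by rewrite !gt_eqF ?subr_gt0 ?addr_gt0.
Qed.

End OneSide.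

(** Two regimes. For large [lam] both terms are at most [eta], uniformly in [h] thanks to [Z]. For
    bounded [lam], [z = h sqrt lam] is small and the exponents differ by [O(x z)], where
    [x = L sqrt lam]. *)
Lemma cratio_limit (L Z eta : R) : 0 < L -> 0 < Z -> 0 < eta ->
  exists2 delta : R, 0 < delta & forall (N : nat) (lam : R), (0 < N)%N -> 0 < lam ->
    L / N%:R < delta -> lam * (L / N%:R) ^+ 2 <= Z ->
    `|cratio (L / N%:R) lam ^+ N - expR (- (2 * (Num.sqrt lam * L)))| <= eta.
Proof.
(* This constant gives [c z <= t] as long as [z^2 <= Z]. *)
move=> L0 Z0 e0; pose c := (1 + Z / 3)^-1.
have c0 : 0 < c by rewrite invr_gt0 ltr_wpDr// divr_ge0// ltW.
have c1 : c <= 1 by rewrite invf_le1 ?lerDl ?divr_ge0 ?(ltW Z0)// ltr_wpDr// divr_ge0// ltW.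
(* The threshold for [sqrt lam]: beyond it [c x >= eta^-1], hence [exp (- c x) <= eta]. *)
pose Lam := (c * L * eta)^-1.
have Lam0 : 0 < Lam by rewrite invr_gt0 !mulr_gt0.
(* Below the threshold the two bounds give [z <= 1/2] and [8 x z <= min eta 1]. *)
pose delta := Num.min (2 * Lam)^-1 (Num.min eta 1 / (8 * Lam ^+ 2 * L)).
have delta0 : 0 < delta.
  rewrite /delta lt_min invr_gt0 mulr_gt0//= divr_gt0 ?lt_min ?e0 ?ltr01//.
  by rewrite !mulr_gt0// exprn_gt0.
exists delta => // N lam N0 lam0 hd hZ.
set h := L / N%:R in hd hZ *; set l := Num.sqrt lam.
have h0 : 0 < h by rewrite divr_gt0// ltr0n.
have NR0 : 0 < N%:R :> R by rewrite ltr0n.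
have l0 : 0 < l by rewrite sqrtr_gt0.
have l2 : l ^+ 2 = lam by rewrite sqr_sqrtr// ltW.
set t := csqrt h lam / cdiag h lam.
have t0 : 0 < t := decay_gt0 h0 lam0.
have tz : t <= l * h := decay_upper h0 lam0.
have zt : l * h / (1 + (l * h) ^+ 2 / 3) <= t := decay_lower h0 lam0.
have t1 : t <= 1 := decay_le1 h0 lam0.
have hN : h * N%:R = L by rewrite /h divfK// gt_eqF.
have Qle := cratio_exp_le h0 lam0 N; rewrite -/t in Qle.
have Qge := cratio_exp_ge h0 lam0 N; rewrite -/t in Qge.
clearbody t l h.
have Q0 : 0 <= cratio h lam ^+ N by rewrite exprn_ge0 ?cratio_ge0.
have z0 : 0 < l * h by rewrite mulr_gt0.
have z2Z : (l * h) ^+ 2 <= Z by rewrite exprMn l2.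
have [lLam|lLam] := leP Lam l.
  have cl : c * (l * L) <= t * N%:R.
    have -> : c * (l * L) = (c * (l * h)) * N%:R by rewrite -!mulrA hN.
    rewrite ler_pM2r//; apply: le_trans zt; rewrite mulrC ler_pM2l//.
    have w1 : 0 < 1 + (l * h) ^+ 2 / 3 by rewrite ltr_wpDr// divr_ge0// sqr_ge0.
    have w2 : 0 < 1 + Z / 3 by rewrite ltr_wpDr// divr_ge0// ltW.
    by rewrite /c lef_pV2 ?posrE//; lra.
  have big : eta^-1 <= c * (l * L).
    have -> : eta^-1 = c * L * Lam by rewrite /Lam; field; rewrite !gt_eqF.
    by rewrite [l * L]mulrC mulrA ler_pM2l// mulr_gt0.
  have small (y : R) : c * (l * L) <= y -> expR (- y) <= eta.
    move=> cy; have y0 : 0 < y by apply: lt_le_trans cy; rewrite !mulr_gt0.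
    apply: le_trans (expRN_le (ltW y0)) _.
    rewrite -[leRHS]invrK lef_pV2 ?posrE ?invr_gt0//; last by rewrite addr_gt0.
    by rewrite (le_trans big)// (le_trans cy)// lerDr.
  have Qs : cratio h lam ^+ N <= eta.
    apply: le_trans Qle (small _ _); apply: le_trans cl _.
    by rewrite ler_pdivlMr ?addr_gt0//; have := mulr_gt0 t0 NR0; nra.
  have Es : expR (- (2 * (l * L))) <= eta.
    by apply: small; rewrite ler_pM2r ?mulr_gt0//; lra.
  have := expR_ge0 (- (2 * (l * L))); rewrite ler_norml; lra.
set z := l * h in tz zt z0 z2Z.
have zhalf : z <= 2^-1.
  have : h < (2 * Lam)^-1 by apply: lt_le_trans hd _; rewrite /delta ge_min lexx.
  rewrite -[_^-1]div1r ltr_pdivlMr ?mulr_gt0// => hL.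
  have : l * h <= Lam * h by rewrite ler_pM2r// ltW.
  by rewrite -/z; lra.
have xz : 8 * (l * L * z) <= Num.min eta 1.
  have : h < Num.min eta 1 / (8 * Lam ^+ 2 * L).
    by apply: lt_le_trans hd _; rewrite /delta ge_min lexx orbT.
  rewrite ltr_pdivlMr ?(mulr_gt0, exprn_gt0)// => /ltW; apply: le_trans.
  have -> : 8 * (l * L * z) = h * (8 * l ^+ 2 * L) by rewrite /z; ring.
  rewrite ler_pM2l// ler_pM2r// ler_pM2l// lerXn2r ?nnegrE ?ltW//.
have xeta : 8 * (l * L * z) <= eta by apply: le_trans xz _; rewrite ge_min lexx.
have x1 : 8 * (l * L * z) <= 1 by apply: le_trans xz _; rewrite ge_min lexx orbT.
set x := l * L in xeta x1 *.
have x0 : 0 < x by rewrite mulr_gt0.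
have zN : z * N%:R = x by rewrite /z -mulrA hN.
have xz0 : 0 < x * z by rewrite mulr_gt0.
have ex1 : expR (- (2 * x)) <= 1 by rewrite expR_le1 oppr_le0 mulr_ge0// ltW.
have ex0 := expR_ge0 (- (2 * x)).
have Qup : cratio h lam ^+ N <= expR (- (2 * x)) * (1 + 8 * (x * z)).
  apply: (le_trans Qle).
  have -> : expR (- (2 * (t * N%:R) / (1 + t))) =
      expR (- (2 * x)) * expR (2 * x - 2 * (t * N%:R) / (1 + t)).
    by rewrite -expRD; congr expR; ring.
  rewrite ler_wpM2l//.
  have ub : 2 * x - 2 * (t * N%:R) / (1 + t) <= 4 * (x * z).
    have w0 : 0 < 1 + z ^+ 2 / 3 by rewrite ltr_wpDr// divr_ge0// sqr_ge0.
    have : z * (1 - 2 * z) <= t / (1 + t).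
      rewrite ler_pdivlMr ?addr_gt0//; apply: le_trans zt; rewrite ler_pdivlMr//.
      have -> : z * (1 - 2 * z) * (1 + t) * (1 + z ^+ 2 / 3) =
          z * ((1 - 2 * z) * ((1 + t) * (1 + z ^+ 2 / 3))) by ring.
      rewrite ler_piMr ?(ltW z0)//.
      apply: (@le_trans _ _ ((1 - 2 * z) * ((1 + z) * (1 + z ^+ 2 / 3)))).
        by rewrite ler_wpM2l ?ler_pM2r//; lra.
      have := exprn_gt0 3 z0; have := sqr_ge0 z.
      rewrite (_ : z ^+ 3 = z * z ^+ 2) ?exprS//.
      by move: (z ^+ 2) => q; nra.
    rewrite -(ler_pM2r NR0) => H.
    have e1 : 2 * (t * N%:R) / (1 + t) = 2 * (t / (1 + t) * N%:R) by ring.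
    have e2 : z * (1 - 2 * z) * N%:R = x * (1 - 2 * z) by rewrite -zN; ring.
    by rewrite e1; rewrite e2 in H; lra.
  rewrite -ler_expR in ub; apply: (le_trans ub).
  (* [exp q <= 1 / (1 - q) <= 1 + 2 q] with [q = 4 x z <= 1/2]. *)
  have q1 : 0 < 1 - 4 * (x * z) by lra.
  rewrite -[leLHS]invrK -expRN -[leRHS]invrK lef_pV2 ?posrE ?invr_gt0 ?expR_gt0//; last by lra.
  apply: le_trans (expR_ge1Dx _).
  rewrite -[leLHS]div1r ler_pdivrMr; last by lra.
  by move: (x * z) xz0 x1 q1 => q; nra.
have Qlow : expR (- (2 * x)) * (1 - 8 * (x * z)) <= cratio h lam ^+ N.
  have t1' : t < 1 by lra.
  apply: le_trans (Qge t1').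
  have -> : expR (- (2 * (t * N%:R) / (1 - t))) =
      expR (- (2 * x)) * expR (2 * x - 2 * (t * N%:R) / (1 - t)).
    by rewrite -expRD; congr expR; ring.
  rewrite ler_wpM2l//; apply: le_trans (expR_ge1Dx _).
  have : t / (1 - t) <= z * (1 + 2 * z).
    rewrite ler_pdivrMr ?subr_gt0//; apply: (le_trans tz).
    apply: (@le_trans _ _ (z * (1 + 2 * z) * (1 - z))); first nra.
    by rewrite ler_pM2l ?mulr_gt0//; lra.
  rewrite -(ler_pM2r NR0) => H.
  have e1 : 2 * (t * N%:R) / (1 - t) = 2 * (t / (1 - t) * N%:R) by ring.
  have e2 : z * (1 + 2 * z) * N%:R = x * (1 + 2 * z) by rewrite -zN; ring.
  by rewrite e1; rewrite e2 in H; lra.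
rewrite ler_norml; apply/andP; split; nra.
Qed.

(** This is [coth y] for [q = exp (- 2 y)]. *)
Definition coth_factor (q : R) : R := (1 + q) / (1 - q).

Lemma energyE (h lam : R) N : energy h lam N = csqrt h lam * coth_factor (cratio h lam ^+ N).
Proof. by []. Qed.

Lemma coth_factor_ratio (L Zm Zp eps : R) : 0 < L -> 0 < Zm -> 0 < Zp -> 0 < eps ->
  exists2 delta : R, 0 < delta & forall (Nm Np : nat) (lam : R),
    (0 < Nm)%N -> (0 < Np)%N -> 4^-1 <= lam ->
    L / Nm%:R < delta -> L / Np%:R < delta ->
    lam * (L / Nm%:R) ^+ 2 <= Zm -> lam * (L / Np%:R) ^+ 2 <= Zp ->
    `|coth_factor (cratio (L / Np%:R) lam ^+ Np) /
      coth_factor (cratio (L / Nm%:R) lam ^+ Nm) - 1| <= eps.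
Proof.
(* [k] bounds [1 - exp (- 2 L sqrt lam)] from below, by [2 sqrt lam >= 1] and
   [exp (- L) <= 1 / (1 + L)]. *)
move=> L0 Zm0 Zp0 eps0; pose k := L / (1 + L).
have L1 : 0 < 1 + L by rewrite addr_gt0.
have k0 : 0 < k by rewrite divr_gt0.
(* The first bound keeps [1 - Q >= k / 2] on both sides; the second makes [2 |Qp - Qm|] at most
   [eps] times the denominator. *)
pose eta := Num.min (k / 2) (eps * k / 8).
have eta0 : 0 < eta by rewrite lt_min !(divr_gt0, mulr_gt0).
have etak : eta <= k / 2 by rewrite ge_min lexx.
have etae : 8 * eta <= eps * k.
  by rewrite mulrC -ler_pdivlMr// /eta ge_min lexx orbT.
have [dm dm0 Hm] := cratio_limit L0 Zm0 eta0.
have [dp dp0 Hp] := cratio_limit L0 Zp0 eta0.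
exists (Num.min dm dp); first by rewrite lt_min dm0.
move=> Nm Np lam Nm0 Np0 lam4; rewrite !lt_min => /andP[hm _] /andP[_ hp] hZm hZp.
have lam0 : 0 < lam by lra.
have := Hm _ _ Nm0 lam0 hm hZm; have := Hp _ _ Np0 lam0 hp hZp.
have Qm0 : 0 <= cratio (L / Nm%:R) lam ^+ Nm.
  by rewrite exprn_ge0 ?cratio_ge0// divr_gt0// ltr0n.
have Qp0 : 0 <= cratio (L / Np%:R) lam ^+ Np.
  by rewrite exprn_ge0 ?cratio_ge0// divr_gt0// ltr0n.
have ek : expR (- (2 * (Num.sqrt lam * L))) <= 1 - k.
  have -> : 1 - k = (1 + L)^-1 by rewrite /k; field; rewrite gt_eqF.
  apply: le_trans (expRN_le (ltW L0)); rewrite ler_expR lerN2 mulrA ler_peMl ?(ltW L0)//.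
  have : Num.sqrt (4^-1 : R) <= Num.sqrt lam by apply: ler_wsqrtr.
  have -> : (4^-1 : R) = 2^-1 ^+ 2 by field.
  by rewrite sqrtr_sqr ger0_norm ?invr_ge0// => H; lra.
move: Qm0 Qp0 ek; move: (expR _) (cratio _ _ ^+ _) (cratio _ _ ^+ _) => E Qp Qm Qm0 Qp0 ek.
rewrite !ler_norml => /andP[p1 p2] /andP[m1 m2].
have dp1 : k / 2 <= 1 - Qp by lra.
have dm1 : k / 2 <= 1 - Qm by lra.
have k2 : 0 < k / 2 by rewrite divr_gt0.
have dp' : 0 < 1 - Qp by lra.
have dm' : 0 < 1 - Qm by lra.
have pm : 0 < 1 + Qm by lra.
have -> : coth_factor Qp / coth_factor Qm - 1 = 2 * (Qp - Qm) / ((1 - Qp) * (1 + Qm)).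
  by rewrite /coth_factor; field; rewrite !gt_eqF.
have den : k / 2 <= (1 - Qp) * (1 + Qm) by nra.
have D0 : 0 < (1 - Qp) * (1 + Qm) by rewrite mulr_gt0.
have epsk : eps * (k / 2) <= eps * ((1 - Qp) * (1 + Qm)) by rewrite ler_pM2l.
by rewrite ler_pdivlMr// ler_pdivrMr//; apply/andP; split; lra.
Qed.

End Decay.

(** * Two elementary estimates for the cosine *)

Section Cosine.
Context {R : realType}.

Lemma cos_lipschitz (a b : R) : `|cos a - cos b| <= `|a - b|.
Proof.
wlog ab : a b / a <= b => [H|].
  by case: (leP a b) => [/H//|/ltW/H]; rewrite distrC [X in _ <= X]distrC.
have [|c _] := @MVT_segment R cos (fun x => - sin x) a b ab.
- exact/continuous_subspaceT/continuous_cos.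
- rewrite distrC [X in _ <= X]distrC => ->; rewrite normrM normrN ler_piMl//.
  by rewrite ler_norml sin_geN1 sin_le1.
Qed.

(** Near 0 the cosine is at least 1/2, so [sin (x / 2) >= x / 4], and [1 - cos x = 2 sin^2 (x / 2)].
    This keeps the lowest discrete frequency away from 0. *)
Lemma one_sub_cos_lower : exists2 d : R, 0 < d & d <= pi /\
  forall x, 0 < x < d -> x ^+ 2 / 8 <= 1 - cos x.
Proof.
have /cvgrPdist_lt/(_ 2^-1) := @continuous_cos R 0.
rewrite invr_gt0 ltr0n => /(_ isT)[d /= d0 cd].
have c12 y : 0 <= y < d -> 2^-1 <= cos y.
  move=> /andP[y0 yd]; have := cd y; rewrite /= sub0r normrN ger0_norm// cos0.
  by move=> /(_ yd); rewrite ltr_norml; lra.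
exists (Num.min d pi); first by rewrite lt_min d0 pi_gt0.
split; first by rewrite ge_min lexx orbT.
move=> x; rewrite lt_min => /and3P[x0 xd _].
have x2 : 0 <= x / 2 by rewrite divr_ge0// ltW.
have [|c] := @MVT_segment R sin cos 0 (x / 2) x2.
- exact/continuous_subspaceT/continuous_sin.
rewrite in_itv/= sin0 !subr0 => /andP[c0 cx] sE.
have cc : 2^-1 <= cos c by apply: c12; rewrite c0/=; lra.
have sx : x / 4 <= sin (x / 2) by rewrite sE; nra.
have -> : cos x = 1 - 2 * sin (x / 2) ^+ 2.
  have -> : x = x / 2 + x / 2 by field.
  rewrite cosD; have := cos2Dsin2 (x / 2).
  rewrite -!expr2 (_ : (x / 2 + x / 2) / 2 = x / 2); last by field.
  by lra.
nra.
Qed.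

End Cosine.

(** * The limit of the energy ratio *)

Section LimitRatio.
Context {R : realType}.
Variables (L r ry : R).
Hypotheses (L0 : 0 < L) (r0 : 0 < r) (ry0 : 0 < ry).

(** The frequency in scale-free form: [lam h_y^2 = 6 tau], with [c] the cosine of the angle. *)
Definition tau (c : R) : R := (1 - c) / (2 + c).

Lemma tau_itv c : -1 < c < 1 -> 0 < tau c < 2.
Proof.
move=> /andP[c1 c2]; have c3 : 0 < 2 + c by lra.
by rewrite /tau divr_gt0 ?ltr_pdivrMr//=; lra.
Qed.

(* Square of the limit of [energy h_plus / energy h_minus], the influence of the
   outer boundary being neglected. *)
Definition rho2 (t : R) : R := (2 * ry ^+ 2 + r ^+ 2 * t) / (2 * ry ^+ 2 + t).

Let ry2 : 0 < ry ^+ 2. Proof. exact: exprn_gt0. Qed.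
Let r2 : 0 < r ^+ 2. Proof. exact: exprn_gt0. Qed.

(** [rho2] is monotone in [t], in a direction given by the sign of [r - 1], with the two bounds as
    its values at 0 and 2. *)
Lemma rho2_between t : 0 < t < 2 ->
  (1 <= rho2 t <= (r ^+ 2 + ry ^+ 2) / (1 + ry ^+ 2)) \/
  ((r ^+ 2 + ry ^+ 2) / (1 + ry ^+ 2) <= rho2 t <= 1).
Proof.
move=> /andP[t0 t2]; rewrite /rho2; move: (ry ^+ 2) (r ^+ 2) ry2 r2 => q p q0 p0.
have d0 : 0 < 2 * q + t by lra.
have e0 : 0 < 1 + q by lra.
have -> : (2 * q + p * t) / (2 * q + t) = (p + q) / (1 + q) +
    (p - 1) * (q * (t - 2)) / ((1 + q) * (2 * q + t)).
  by field; rewrite !gt_eqF.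
have n0 : q * (t - 2) < 0 by nra.
have D0 : 0 < (1 + q) * (2 * q + t) by rewrite mulr_gt0.
have E : (p + q) / (1 + q) + (p - 1) * (q * (t - 2)) / ((1 + q) * (2 * q + t)) =
    1 + (p - 1) * (t * (1 + q)) / ((1 + q) * (2 * q + t)).
  by field; rewrite !gt_eqF.
have n1 : 0 < t * (1 + q) by rewrite mulr_gt0.
case: (leP 1 p) => p1; [left|right]; apply/andP; split.
- by rewrite E lerDl divr_ge0 ?(ltW D0)// mulr_ge0 ?subr_ge0// ltW.
- by rewrite gerDl pmulr_lle0 ?invr_gt0// mulr_ge0_le0 ?subr_ge0// ltW.
- by rewrite lerDl pmulr_lge0 ?invr_gt0// mulr_le0 ?subr_le0// ltW.
- by rewrite E gerDl pmulr_lle0 ?invr_gt0// mulr_le0_ge0 ?subr_le0// ltW.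
Qed.

Section Mesh.
Variables (Nm Np M : nat).
Hypothesis adm : admissible L Nm Np M r ry.
Variable k : 'I_M.-1.

Local Notation hm := (h_minus L Nm).
Local Notation hp := (h_plus L Np).
Local Notation c := (cos (k.+1%:R * (pi / M%:R)) : R).
Local Notation lam := (@ylambda R M k).

Let M0 : (0 < M)%N. Proof. by case: adm. Qed.
Let hm0 : 0 < hm. Proof. by case: adm => N0 _ _ _ _; rewrite divr_gt0 ?ltr0n. Qed.
Let hyE : pi / M%:R = ry * hm. Proof. by case: adm. Qed.
Let hpE : hp = r * hm. Proof. by case: adm. Qed.

Let t02 : 0 < tau c < 2. Proof. exact/tau_itv/cos_gtN1. Qed.

Lemma ylambda_hm : lam * hm ^+ 2 = 6 * tau c / ry ^+ 2.
Proof.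
rewrite /ylambda -/(tau c); move: (tau c) => t; rewrite hyE; move: hm hm0 => h h0.
by field; rewrite !gt_eqF.
Qed.

Lemma ylambda_hm_le : lam * hm ^+ 2 <= 12 / ry ^+ 2.
Proof. by rewrite ylambda_hm ler_pM2r ?invr_gt0//; move/andP: t02; lra. Qed.

Lemma ylambda_hp_le : lam * hp ^+ 2 <= 12 * r ^+ 2 / ry ^+ 2.
Proof.
have -> : lam * hp ^+ 2 = r ^+ 2 * (lam * hm ^+ 2) by rewrite hpE; ring.
have -> : 12 * r ^+ 2 / ry ^+ 2 = r ^+ 2 * (12 / ry ^+ 2) by ring.
by rewrite ler_pM2l// ylambda_hm_le.
Qed.

Lemma csqrt_ratio : csqrt hp lam = csqrt hm lam * Num.sqrt (rho2 (tau c)).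
Proof.
have l0 : 0 < lam := ylambda_gt0 M0 k.
have w0 : 0 < 1 + lam * hm ^+ 2 / 12.
  by rewrite ltr_wpDr// divr_ge0// mulr_ge0 ?sqr_ge0// ltW.
rewrite /csqrt -sqrtrM; last by rewrite ltW// mulr_gt0.
congr Num.sqrt; rewrite -[RHS]mulrA; congr (_ * _).
have -> : lam * hp ^+ 2 = r ^+ 2 * (lam * hm ^+ 2) by rewrite hpE; ring.
rewrite ylambda_hm /rho2; move/andP: t02 => [t0 _]; move: (tau c) t0 => t t0.
field; rewrite !gt_eqF ?addr_gt0 ?mulr_gt0//.
Qed.

(** The lowest frequency is the worst: [1 - c >= h_y^2 / 8] and [2 + c <= 3] give
    [6 / (8 * 3) = 1/4]. *)
Lemma ylambda_ge (d : R) : d <= pi ->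
  (forall x : R, 0 < x < d -> x ^+ 2 / 8 <= 1 - cos x) -> ry * hm < d -> 4^-1 <= lam.
Proof.
move=> dpi cd hd; have y0 : 0 < pi / M%:R :> R by rewrite hyE mulr_gt0.
have yd : pi / M%:R < d by rewrite hyE.
have := cd (pi / M%:R); rewrite y0 yd => /(_ isT) cy.
have kM : (k.+1 < M)%N by rewrite -ltn_predRL.
have th : pi / M%:R <= k.+1%:R * (pi / M%:R) :> R by rewrite ler_peMl ?ler1n// ltW.
have th2 : k.+1%:R * (pi / M%:R) <= pi :> R.
  rewrite mulrA ler_pdivrMr ?ltr0n// mulrC ler_pM2l ?pi_gt0// ler_nat.
  exact: ltnW.
have cc : c <= cos (pi / M%:R).
  have m1 : pi / M%:R \in `[0, pi :> R] by rewrite in_itv/= !ltW// (lt_le_trans yd).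
  have m2 : k.+1%:R * (pi / M%:R) \in `[0, pi :> R].
    by rewrite in_itv/= th2 (le_trans (ltW y0) th).
  by rewrite leNgt; apply/negP; rewrite (ltr_cos m2 m1) ltNge th.
have /andP[c1 c2] := @cos_gtN1 R M M0 k.
rewrite /ylambda; move: (cos (k.+1%:R * _)) cc c1 c2 => C cc c1 c2.
move: (pi / M%:R) y0 cy cc {th th2 yd} => h h0 cy cc.
have h2 : 0 < h ^+ 2 by exact: exprn_gt0.
have C3 : 0 < 2 + C by lra.
have -> : 6 / h ^+ 2 * ((1 - C) / (2 + C)) = 6 * (1 - C) / (h ^+ 2 * (2 + C)).
  by field; rewrite !gt_eqF.
rewrite ler_pdivlMr ?mulr_gt0//.
have : h ^+ 2 * (2 + C) <= h ^+ 2 * 3 by rewrite ler_pM2l//; lra.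
by lra.
Qed.

End Mesh.

Lemma energy_ratio (eps : R) : 0 < eps -> exists2 delta : R, 0 < delta &
  forall Nm Np M : nat, admissible L Nm Np M r ry -> h_minus L Nm < delta ->
  forall k : 'I_M.-1, exists2 g : R, `|g - 1| <= eps &
    energy (h_plus L Np) (ylambda M k) Np = energy (h_minus L Nm) (ylambda M k) Nm *
      (Num.sqrt (rho2 (tau (cos (k.+1%:R * (pi / M%:R))))) * g).
Proof.
move=> eps0.
have Zm0 : 0 < 12 / ry ^+ 2 by rewrite divr_gt0.
have Zp0 : 0 < 12 * r ^+ 2 / ry ^+ 2 by rewrite divr_gt0// mulr_gt0.
have [d1 d10 H] := coth_factor_ratio L0 Zm0 Zp0 eps0.
have [d2 d20 [d2pi cd]] := @one_sub_cos_lower R.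
(* The thresholds control [h_minus], [h_plus] and [h_y] in turn. *)
exists (Num.min d1 (Num.min (d1 / r) (d2 / ry))); first by rewrite !lt_min d10 !divr_gt0.
move=> Nm Np M adm; rewrite !lt_min => /and3P[h1 hr hy] k.
have [Nm0 Np0 M0 hpE hyE] := adm.
have lam4 : (4^-1 : R) <= ylambda M k.
  by apply: (ylambda_ge adm k d2pi cd); rewrite mulrC -ltr_pdivlMr.
have hp1 : h_plus L Np < d1 by rewrite hpE mulrC -ltr_pdivlMr.
have := H Nm Np (ylambda M k) Nm0 Np0 lam4 h1 hp1 (ylambda_hm_le adm k)
  (ylambda_hp_le adm k).
rewrite -/(h_minus L Nm) -/(h_plus L Np) => Hg; eexists; first exact: Hg.
rewrite !energyE (csqrt_ratio adm).
have l0 : 0 < ylambda M k :> R by lra.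
have hm0 : 0 < h_minus L Nm by rewrite divr_gt0// ltr0n.
have Q1 := cratioN_lt1 hm0 l0 Nm0.
have Q0 : 0 <= cratio (h_minus L Nm) (ylambda M k) ^+ Nm by rewrite exprn_ge0 ?cratio_ge0.
move: (Num.sqrt _) (coth_factor (cratio (h_plus L Np) _ ^+ Np)) (csqrt _ _) => s cp cs.
have cm0 : coth_factor (cratio (h_minus L Nm) (ylambda M k) ^+ Nm) != 0.
  by rewrite gt_eqF// divr_gt0 ?subr_gt0// ltr_wpDr.
by move: (coth_factor _) cm0 => cm cm0; field.
Qed.

End LimitRatio.

(** * Comparison of the eigenvalues with the stated bound *)

Section EigenvalueBounds.
Context {R : realType}.
Implicit Types (kap rho S A B : R).

(** For [kap < 0] the map [x -> (1 + kap x) / (1 + x)] decreases; here it is still positive at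
    [x = A / S]. *)
Lemma gap_decreasing kap rho S A : kap < 0 -> 0 < S -> 0 < A -> 0 < rho ->
  rho * S <= A -> 0 < S + kap * A ->
  `|S + kap * A| / (S + A) <= `|1 + kap * rho| / (1 + rho).
Proof.
move=> k0 S0 A0 r0 rSA SA.
have kr : 0 < 1 + kap * rho.
  have : 0 < S * (1 + kap * rho) by nra.
  by rewrite pmulr_rgt0.
rewrite !gtr0_norm// ler_pdivlMr ?addr_gt0// mulrAC ler_pdivrMr ?addr_gt0//.
by nra.
Qed.

(** Beyond its zero the same map has increasing modulus. [B] allows for [1 + eps] in the denominator
    of the bound while the numerator has [1 - eps]. *)
Lemma gap_increasing kap rho S A B : kap < 0 -> 0 < S -> 0 < A -> 0 < rho ->
  A <= rho * S -> A <= B -> S + kap * A < 0 ->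
  `|S + kap * A| / (S + B) <= `|1 + kap * rho| / (1 + rho).
Proof.
move=> k0 S0 A0 r0 rSA AB SA.
have kr : 1 + kap * rho < 0.
  have : S * (1 + kap * rho) < 0 by nra.
  by rewrite pmulr_rlt0.
rewrite !ltr0_norm//; apply: (@le_trans _ _ (- (S + kap * A) / (S + A))).
  by rewrite ler_pM2l ?oppr_gt0// lef_pV2 ?posrE ?addr_gt0//; lra.
rewrite ler_pdivlMr ?addr_gt0// mulrAC ler_pdivrMr ?addr_gt0//.
by nra.
Qed.

Lemma mode_eigenvalueE (sm sp E rho : R) : sm < 0 -> 0 < E -> 0 < rho ->
  (sm * E + sp * (E * rho)) / (E + E * rho) = sm * ((1 + sp / sm * rho) / (1 + rho)).
Proof.
move=> sm0 E0 r0; field.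
have Er : 0 < E * rho by rewrite mulr_gt0.
by apply/and3P; split; rewrite ?(lt_eqF sm0)// gt_eqF// addr_gt0.
Qed.

Section MinTerm.
Variables (kap r ry eps : R).
Hypotheses (kap0 : kap < 0) (r0 : 0 < r) (ry0 : 0 < ry) (eps0 : 0 < eps < 1).

Local Notation S1 := (Num.sqrt (1 + ry ^+ 2)).
Local Notation S2 := (Num.sqrt (r ^+ 2 + ry ^+ 2)).

Let p1 : 0 < 1 + ry ^+ 2. Proof. by rewrite ltr_wpDr// sqr_ge0. Qed.
Let p2 : 0 < r ^+ 2 + ry ^+ 2. Proof. by rewrite addr_gt0 ?exprn_gt0. Qed.
Let S1_gt0 : 0 < S1. Proof. by rewrite sqrtr_gt0. Qed.
Let S2_gt0 : 0 < S2. Proof. by rewrite sqrtr_gt0. Qed.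

Let S1S1 : S1 ^+ 2 = 1 + ry ^+ 2. Proof. by rewrite sqr_sqrtr// ltW. Qed.
Let S2S2 : S2 ^+ 2 = r ^+ 2 + ry ^+ 2. Proof. by rewrite sqr_sqrtr// ltW. Qed.

Definition low_contrast : Prop :=
  `|kap| * (1 + eps) < 1 /\
  r ^+ 2 * kap ^+ 2 * (1 + eps) ^+ 2 < 1 + ry ^+ 2 * (1 - kap ^+ 2 * (1 + eps) ^+ 2).
Definition high_contrast : Prop :=
  1 < `|kap| * (1 - eps) /\
  1 + ry ^+ 2 * (1 - kap ^+ 2 * (1 - eps) ^+ 2) < r ^+ 2 * kap ^+ 2 * (1 - eps) ^+ 2.

(** The quadratic hypothesis reads [kap^2 (1 + eps)^2 S2^2 < S1^2]. The conclusions are the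
    positivity of [1 + kap rho] at [rho = 1 + eps] and at [rho = (1 + eps) S2 / S1]. *)
Lemma low_contrastE : low_contrast ->
  0 < 1 + kap * (1 + eps) /\ 0 < S1 + kap * ((1 + eps) * S2).
Proof.
move=> []; rewrite ltr0_norm// => c1 c2; split; first by lra.
have : (- kap * (1 + eps) * S2) ^+ 2 < S1 ^+ 2.
  have -> : (- kap * (1 + eps) * S2) ^+ 2 = kap ^+ 2 * (1 + eps) ^+ 2 * S2 ^+ 2 by ring.
  by rewrite S1S1 S2S2; lra.
rewrite ltr_sqr ?nnegrE ?(ltW S1_gt0)//; first by lra.
have k1 : 0 <= - kap by rewrite oppr_ge0 ltW.
by rewrite mulr_ge0 ?(ltW S2_gt0)// mulr_ge0//; move/andP: eps0 => [e0 e1]; lra.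
Qed.

Lemma high_contrastE : high_contrast ->
  1 + kap * (1 - eps) < 0 /\ S1 + kap * ((1 - eps) * S2) < 0.
Proof.
move=> []; rewrite ltr0_norm// => c1 c2; split; first by lra.
have : S1 ^+ 2 < (- kap * (1 - eps) * S2) ^+ 2.
  have -> : (- kap * (1 - eps) * S2) ^+ 2 = kap ^+ 2 * (1 - eps) ^+ 2 * S2 ^+ 2 by ring.
  by rewrite S1S1 S2S2; lra.
rewrite ltr_sqr ?nnegrE ?(ltW S1_gt0)//; first by lra.
have k1 : 0 <= - kap by rewrite oppr_ge0 ltW.
by rewrite mulr_ge0 ?(ltW S2_gt0)// mulr_ge0//; move/andP: eps0 => [e0 e1]; lra.
Qed.

Let min_term_gt0 p : 1 + (1 + p * eps) * kap != 0 ->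
  S1 + (1 + p * eps) * kap * S2 != 0 -> 0 < min_term kap r ry eps p.
Proof.
move=> n1 n2; rewrite /min_term !lt_min ltr01 normr_gt0 lt_eqF//=.
move/andP: eps0 => [e0 e1].
by rewrite !divr_gt0 ?normr_gt0 ?addr_gt0 ?mulr_gt0 ?addr_gt0.
Qed.

(** Each hypothesis controls one sign of [p]; as [kap * eps < 0], the other sign moves the value
    further from 0. *)
Lemma min_terms_gt0 : low_contrast \/ high_contrast ->
  0 < Num.min (min_term kap r ry eps 1) (min_term kap r ry eps (- 1)).
Proof.
move/andP: (eps0) => [e0 e1]; have ke : kap * eps < 0 by rewrite nmulr_rlt0.
have keS : kap * eps * S2 < 0 by rewrite pmulr_llt0.
case=> [/low_contrastE|/high_contrastE] [c1 c2]; rewrite lt_min.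
- by rewrite !min_term_gt0//; rewrite gt_eqF//; lra.
- by rewrite !min_term_gt0//; rewrite lt_eqF//; lra.
Qed.

Lemma min_term_le p : [/\ min_term kap r ry eps p <= 1, min_term kap r ry eps p <= `|kap|,
  min_term kap r ry eps p <= `|1 + (1 + p * eps) * kap| / (2 + eps) &
  min_term kap r ry eps p <= `|S1 + (1 + p * eps) * kap * S2| / (S1 + (1 + eps) * S2)].
Proof. by rewrite /min_term !ge_min !lexx !orbT. Qed.

(** [f] lies between 1 and [S2 / S1]. The worst case is the larger end times [1 + eps] for low
    contrast and the smaller end times [1 - eps] for high contrast. *)
Lemma min_terms_le_gap t g : 0 < t < 2 -> `|g - 1| <= eps ->
  low_contrast \/ high_contrast ->
  Num.min (min_term kap r ry eps 1) (min_term kap r ry eps (- 1)) <=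
  `|1 + kap * (Num.sqrt (rho2 r ry t) * g)| / (1 + Num.sqrt (rho2 r ry t) * g).
Proof.
move=> t02; rewrite ler_norml => /andP[g1 g2] lh; move/andP: (eps0) => [e0 e1].
set f := Num.sqrt _; have S1p := S1_gt0; have S2p := S2_gt0.
have fb : (1 <= f /\ f * S1 <= S2) \/ (S2 <= f * S1 /\ f <= 1).
  have e2 : Num.sqrt ((r ^+ 2 + ry ^+ 2) / (1 + ry ^+ 2)) = S2 / S1.
    by rewrite sqrtrM ?(ltW p2)// sqrtrV// ltW.
  have [] := rho2_between r0 ry0 t02 => /andP[h1 h2]; [left|right].
    by split; [rewrite -[leLHS]sqrtr1|rewrite -ler_pdivlMr// -e2]; exact: ler_wsqrtr.
  by split; [rewrite -ler_pdivrMr// -e2|rewrite -[leRHS]sqrtr1]; exact: ler_wsqrtr.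
have f0 : 0 < f by case: fb => -[h1 h2]; [lra|have := lt_le_trans S2p h1; rewrite pmulr_lgt0].
have g0 : 0 < g by lra.
have rho0 : 0 < f * g by rewrite mulr_gt0.
have [_ _ l3 l4] := min_term_le 1; have [_ _ l3' l4'] := min_term_le (- 1).
case: lh => [/low_contrastE|/high_contrastE] [c1 c2].
  rewrite ge_min; apply/orP; left; case: fb => -[h1 h2].
    apply: (le_trans l4).
    have -> : S1 + (1 + 1 * eps) * kap * S2 = S1 + kap * ((1 + eps) * S2) by ring.
    apply: gap_decreasing => //; first by rewrite mulr_gt0// addr_gt0.
    have fS : 0 <= f * S1 by rewrite mulr_ge0 ?ltW.
    have ge : g <= 1 + eps by lra.
    by have := ler_pM fS (ltW g0) h2 ge; lra.
  apply: (le_trans l3).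
  have -> : 1 + (1 + 1 * eps) * kap = 1 + kap * (1 + eps) by ring.
  have -> : 2 + eps = 1 + (1 + eps) by ring.
  apply: gap_decreasing => //; first by lra.
  by nra.
rewrite ge_min; apply/orP; right; case: fb => -[h1 h2].
  apply: (le_trans l3').
  have -> : 1 + (1 + (- 1) * eps) * kap = 1 + kap * (1 - eps) by ring.
  have -> : 2 + eps = 1 + (1 + eps) by ring.
  apply: gap_increasing => //; [by lra| |by lra].
  by nra.
apply: (le_trans l4').
have -> : S1 + (1 + (- 1) * eps) * kap * S2 = S1 + kap * ((1 - eps) * S2) by ring.
apply: gap_increasing => //.
- by rewrite mulr_gt0//; lra.
- have e1' : 0 <= 1 - eps by lra.
  have ge : 1 - eps <= g by lra.
  by have := ler_pM (ltW S2p) e1' h1 ge; lra.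
- by rewrite ler_pM2r//; lra.
Qed.

End MinTerm.
End EigenvalueBounds.

(** * The critical frequency and the theorem *)

Section CriticalMode.
Context {R : realType}.
Variables (kap r ry : R).
Hypotheses (kap0 : kap < 0) (r0 : 0 < r) (ry0 : 0 < ry).

Definition critical : Prop :=
  (`|kap| < 1 /\ 1 + ry ^+ 2 * (1 - kap ^+ 2) < r ^+ 2 * kap ^+ 2) \/
  (1 < `|kap| /\ r ^+ 2 * kap ^+ 2 < 1 + ry ^+ 2 * (1 - kap ^+ 2)).

(** [tstar] solves [kap^2 rho2 t = 1], which is linear in [t] with leading coefficient [D]. *)
Local Notation D := (kap ^+ 2 * r ^+ 2 - 1).
Local Notation tstar := (2 * ry ^+ 2 * (1 - kap ^+ 2) / D).

(** In each case [1 - kap^2] and [D] have the same sign, and the second inequality is [tstar < 2]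
    cleared of [D]. *)
Lemma critical_tau : critical -> D != 0 /\ 0 < tstar < 2.
Proof.
have q0 : 0 < ry ^+ 2 by rewrite exprn_gt0.
have k0 := kap0.
case=> -[]; rewrite ltr0_norm// => k1 c.
  have kk : kap ^+ 2 < 1.
    have h1 : 0 < 1 - kap by lra.
    have h2 : 0 < 1 + kap by lra.
    have h := mulr_gt0 h1 h2.
    by lra.
  have D0 : 0 < D.
    have h : 0 < ry ^+ 2 * (1 - kap ^+ 2) by rewrite mulr_gt0// subr_gt0.
    by lra.
  split; first by rewrite gt_eqF.
  apply/andP; split; last by rewrite ltr_pdivrMr//; lra.
  by apply: divr_gt0 => //; rewrite mulr_gt0 ?subr_gt0// mulr_gt0.
have kk : 1 < kap ^+ 2.
  have h1 : 0 < 1 - kap by lra.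
  have h2 : 0 < - kap - 1 by lra.
  have h := mulr_gt0 h1 h2.
  by lra.
have D0 : D < 0.
  have h : ry ^+ 2 * (1 - kap ^+ 2) < 0 by rewrite pmulr_rlt0// subr_lt0.
  by lra.
split; first by rewrite lt_eqF.
rewrite -divrNN divr_gt0 ?oppr_gt0//=; last first.
  by rewrite pmulr_rlt0 ?mulr_gt0// subr_lt0.
by rewrite ltr_pdivrMr ?oppr_gt0//; lra.
Qed.

Lemma gap_rho2 t : 0 < t -> D != 0 ->
  1 - kap ^+ 2 * rho2 r ry t = - D * (t - tstar) / (2 * ry ^+ 2 + t).
Proof.
move=> t0 D0; have q0 : 0 < ry ^+ 2 by rewrite exprn_gt0.
rewrite /rho2; move: (ry ^+ 2) q0 => q q0; move: D0 => D0; field.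
by rewrite exprMn D0 gt_eqF// addr_gt0// mulr_gt0.
Qed.

Lemma rho2_le t : 0 < t -> Num.sqrt (rho2 r ry t) <= 1 + r.
Proof.
move=> t0; have q0 : 0 < ry ^+ 2 by rewrite exprn_gt0.
have r1 : 0 < 1 + r by rewrite addr_gt0.
rewrite -[leRHS]ger0_norm ?(ltW r1)// -sqrtr_sqr; apply: ler_wsqrtr.
rewrite /rho2 ler_pdivrMr ?addr_gt0 ?mulr_gt0//.
have rr : 0 < r ^+ 2 by rewrite exprn_gt0.
have r0' := r0.
have a1 : 2 * ry ^+ 2 <= (1 + r) ^+ 2 * (2 * ry ^+ 2).
  have h1 : 1 <= (1 + r) ^+ 2 by lra.
  by rewrite ler_peMl// mulr_ge0// ltW.
have a2 : r ^+ 2 * t <= (1 + r) ^+ 2 * t by rewrite ler_pM2r//; lra.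
by rewrite mulrDr lerD.
Qed.

Lemma rho2_gt0 t : 0 < t -> 0 < Num.sqrt (rho2 r ry t).
Proof.
move=> t0; rewrite sqrtr_gt0 divr_gt0// addr_gt0// ?mulr_gt0 ?exprn_gt0//.
Qed.

(** Difference of squares; the other factor [1 - kap sqrt x] is at least 1. *)
Lemma sqrt_gap_le x : 0 <= x -> `|1 + kap * Num.sqrt x| <= `|1 - kap ^+ 2 * x|.
Proof.
move=> x0; have s0 := sqrtr_ge0 x.
have -> : 1 - kap ^+ 2 * x = (1 + kap * Num.sqrt x) * (1 - kap * Num.sqrt x).
  by rewrite -{1}(sqr_sqrtr x0); ring.
have ks : kap * Num.sqrt x <= 0 by rewrite mulr_le0_ge0// ltW.
by rewrite normrM ler_peMr// ger0_norm; lra.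
Qed.

(* [theta] is the frequency at which the two half-space energies balance. *)
Lemma critical_frequency : critical -> exists2 theta : R, 0 < theta < pi &
  exists2 B : R, 0 < B & forall x, -1 < cos x < 1 ->
    `|1 + kap * Num.sqrt (rho2 r ry (tau (cos x)))| <= B * `|x - theta|.
Proof.
move=> /critical_tau[D0 tst]; have /andP[ts0 ts2] := tst.
move: (tstar) ts0 ts2 (fun t t0 => @gap_rho2 t t0 D0) => ts ts0 ts2 gapE {tst}.
have q0 : 0 < ry ^+ 2 by rewrite exprn_gt0.
(* The cosine at which [tau] takes the value [ts]. *)
pose cs := (1 - 2 * ts) / (1 + ts).
have t1 : 0 < 1 + ts by lra.
have cs1 : -1 < cs by rewrite /cs ltr_pdivlMr//; lra.
have cs2 : cs < 1 by rewrite /cs ltr_pdivrMr//; lra.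
exists (acos cs).
  by rewrite acos_gt0 ?acos_ltpi// ?cs1 ?cs2 ?(ltW cs1) ?(ltW cs2).
have csE : cos (acos cs) = cs by rewrite acosK// in_itv/= !ltW.
have ts_tau : tau cs = ts by rewrite /tau /cs; field; rewrite gt_eqF//; lra.
(* [|D|] comes from [gap_rho2], 3 from the Lipschitz bound for [tau (cos x)], and the denominator is
   at least [2 ry^2]. *)
exists (`|D| * 3 / (2 * ry ^+ 2)).
  by rewrite divr_gt0 ?mulr_gt0 ?normr_gt0.
move=> x cx; have /andP[c1 c2] := cx.
have /andP[t0 _] := tau_itv cx.
have rho0 : 0 <= rho2 r ry (tau (cos x)).
  by rewrite ltW// -sqrtr_gt0 rho2_gt0.
apply: (le_trans (sqrt_gap_le rho0)); rewrite gapE//.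
have tl : `|tau (cos x) - ts| <= 3 * `|x - acos cs|.
  have -> : tau (cos x) - ts = 3 * (cs - cos x) / ((2 + cos x) * (2 + cs)).
    rewrite -ts_tau /tau; move: (cos x) c1 => c c1; field.
    by rewrite !gt_eqF//; lra.
  have d1 : 1 <= (2 + cos x) * (2 + cs) by nra.
  rewrite !normrM normfV ger0_norm//.
  rewrite ler_pdivrMr; last by rewrite normr_gt0 gt_eqF// (lt_le_trans ltr01).
  rewrite (@ger0_norm _ ((2 + cos x) * (2 + cs))); last by rewrite (le_trans ler01).
  have := cos_lipschitz (acos cs) x; rewrite csE (distrC (acos cs)) => lip.
  apply: (@le_trans _ _ (3 * `|x - acos cs|)); first by rewrite ler_pM2l.
  by rewrite ler_peMr// mulr_ge0.
have q20 : 0 < 2 * ry ^+ 2 by rewrite mulr_gt0.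
have den : 0 < 2 * ry ^+ 2 + tau (cos x) by rewrite addr_gt0.
rewrite !normrM normrN normfV (gtr0_norm den).
apply: (@le_trans _ _ (`|D| * (3 * `|x - acos cs|) / (2 * ry ^+ 2))); last first.
  by rewrite le_eqVlt; apply/orP; left; apply/eqP; ring.
apply: ler_pM.
- by rewrite mulr_ge0.
- by rewrite invr_ge0 ltW.
- by rewrite ler_wpM2l.
- by rewrite lef_pV2 ?posrE// lerDl ltW.
Qed.

End CriticalMode.

Theorem theorem3p33 (R : realType) (L sm sp r ry : R)
  (hL : 0 < L) (hsm : sm < 0) (hsp : 0 < sp) (hr : 0 < r) (hry : 0 < ry) :
  let kappa := sp / sm in
  (forall eps : R, 0 < eps < 1 ->
     ((`|kappa| * (1 + eps) < 1 /\
       r ^+ 2 * kappa ^+ 2 * (1 + eps) ^+ 2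
         < 1 + ry ^+ 2 * (1 - kappa ^+ 2 * (1 + eps) ^+ 2))
      \/
      (1 < `|kappa| * (1 - eps) /\
       1 + ry ^+ 2 * (1 - kappa ^+ 2 * (1 - eps) ^+ 2)
         < r ^+ 2 * kappa ^+ 2 * (1 - eps) ^+ 2)) ->
     exists delta : R, 0 < delta /\
       forall Nm Np M : nat, admissible L Nm Np M r ry ->
         0 < h_minus L Nm < delta ->
         invertible_on (X_h L Nm Np M) (A_h L sm sp Nm Np M) /\
         (inv_norm L (X_h L Nm Np M) (A_h L sm sp Nm Np M)
            <= (inv_bound sm kappa r ry eps)%:E)%E)
  /\
  (((`|kappa| < 1 /\
     1 + ry ^+ 2 * (1 - kappa ^+ 2) < r ^+ 2 * kappa ^+ 2)
    \/
    (1 < `|kappa| /\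
     r ^+ 2 * kappa ^+ 2 < 1 + ry ^+ 2 * (1 - kappa ^+ 2))) ->
   forall C : R, 0 < C ->
     exists eta : R, 0 < eta /\
       forall Nm Np M : nat, admissible L Nm Np M r ry ->
         h_minus L Nm < eta ->
         (C%:E <= inv_norm L (X_h L Nm Np M) (A_h L sm sp Nm Np M))%E).
Proof.
move=> kappa; have kap0 : kappa < 0 by rewrite /kappa pmulr_rlt0// invr_lt0.
have spE : `|sp| = `|sm| * `|kappa|.
  by rewrite -normrM /kappa mulrC divfK// lt_eqF.
have sm0 : 0 < `|sm| by rewrite normr_gt0 lt_eqF.
have modeE Nm Np M (k : 'I_M.-1) g : admissible L Nm Np M r ry -> 0 < g ->
    energy (h_plus L Np) (ylambda M k) Np = energy (h_minus L Nm) (ylambda M k) Nm *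
      (Num.sqrt (rho2 r ry (tau (cos (k.+1%:R * (pi / M%:R))))) * g) ->
    [/\ 0 < tau (cos (k.+1%:R * (pi / M%:R)) : R) < 2,
      0 < Num.sqrt (rho2 r ry (tau (cos (k.+1%:R * (pi / M%:R))))) &
    let rho := Num.sqrt (rho2 r ry (tau (cos (k.+1%:R * (pi / M%:R))))) * g in
    `|mode_eigenvalue L sm sp Nm Np M k| = `|sm| * (`|1 + kappa * rho| / (1 + rho))].
  move=> [Nm0 Np0 M0 _ _] g0 EE.
  have t02 := tau_itv (@cos_gtN1 R M M0 k); have /andP[t0 _] := t02.
  have f0 := rho2_gt0 hr hry t0; split => //=; rewrite /mode_eigenvalue EE.
  have E0 : 0 < energy (h_minus L Nm) (ylambda M k) Nm.
    by rewrite energy_gt0 ?ylambda_gt0// divr_gt0// ltr0n.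
  move: (energy _ _ _) (Num.sqrt _) E0 f0 => E f E0 f0.
  have rho0 : 0 < f * g by rewrite mulr_gt0.
  have rho1 : 0 <= 1 + f * g by lra.
  by rewrite mode_eigenvalueE// normrM normrM normfV (ger0_norm rho1).
clearbody kappa; split.
- move=> eps eps01 hyp.
  have [delta delta0 H] := energy_ratio hL hr hry (andP eps01).1.
  exists delta; split; first exact: delta0.
  move=> Nm Np M adm /andP[_ hd].
  have [Nm0 Np0 M0 _ _] := adm.
  have lh : low_contrast kappa r ry eps \/ high_contrast kappa r ry eps by exact: hyp.
  have m0 := min_terms_gt0 kap0 hr hry eps01 lh.
  rewrite /inv_bound div1r.
  have m1 : Num.min (min_term kappa r ry eps 1) (min_term kappa r ry eps (- 1)) <= 1.
    by have [m1 _ _ _] := min_term_le kappa r ry eps 1; rewrite ge_min m1.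
  have mk : Num.min (min_term kappa r ry eps 1) (min_term kappa r ry eps (- 1)) <= `|kappa|.
    by have [_ mk _ _] := min_term_le kappa r ry eps 1; rewrite ge_min mk.
  apply: A_h_upper => //.
  + by rewrite mulr_gt0.
  + by rewrite ler_piMr// ltW.
  + by rewrite spE ler_pM2l.
  + move=> k; have [g g1 gE] := H Nm Np M adm hd k.
    have g0 : 0 < g by move: g1; rewrite ler_norml; move/andP: eps01 => [? ?] /andP[? ?]; lra.
    have [t02 _ ->] := modeE Nm Np M k g adm g0 gE.
    by rewrite ler_pM2l//; exact: (min_terms_le_gap kap0 hr hry eps01 t02 g1 lh).
- move=> crit C C0.
  have [theta /andP[th0 thpi] [B B0 HB]] := critical_frequency kap0 hr hry crit.
  (* The target: [|1 + kappa rho| <= zeta] yields an eigenvalue of modulus at most [C^-1]. *)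
  pose zeta := (C * `|sm|)^-1.
  have zeta0 : 0 < zeta by rewrite invr_gt0 mulr_gt0.
  have K0 : 0 < `|kappa| * (1 + r) by rewrite mulr_gt0 ?normr_gt0 ?lt_eqF// addr_gt0.
  (* [1/2] keeps [g] positive; the other bound makes the boundary error [|kappa| f |g - 1|] at most
     [zeta / 2], as [f <= 1 + r]. *)
  pose eps := Num.min 2^-1 (zeta / (2 * (`|kappa| * (1 + r)))).
  have eps0 : 0 < eps by rewrite lt_min invr_gt0 ltr0n/= divr_gt0// mulr_gt0.
  have [delta delta0 H] := energy_ratio hL hr hry eps0.
  (* [h_y < theta] ensures a grid angle below [theta], and [B h_y < zeta / 2] the accuracy. *)
  exists (Num.min delta (Num.min (theta / ry) (zeta / (2 * B * ry)))); split.
    by rewrite !lt_min delta0 !divr_gt0// !mulr_gt0.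
  move=> Nm Np M adm; rewrite !lt_min => /and3P[hd hth hB].
  have [Nm0 Np0 M0 _ hyE] := adm.
  have hm0 : 0 < h_minus L Nm by rewrite divr_gt0// ltr0n.
  have y0 : 0 < pi / M%:R :> R by rewrite divr_gt0 ?pi_gt0 ?ltr0n.
  have yth : pi / M%:R < theta by rewrite -/(h_y M) hyE mulrC -ltr_pdivlMr.
  have yB : pi / M%:R * B < zeta / 2.
    rewrite -/(h_y M) hyE; move: hB; rewrite ltr_pdivlMr ?mulr_gt0// => hB.
    by rewrite ltr_pdivlMr//; lra.
  (* [j h_y] is the largest multiple of [h_y] not above [theta]; it misses [theta] by less than
     [h_y]. *)
  have /andP[j1 j2] := truncn_itv (ltW (divr_gt0 th0 y0)).
  set j := Num.truncn _ in j1 j2.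
  have j0 : (0 < j)%N.
    rewrite lt0n; apply/eqP => j0; move: j2; rewrite j0 ltr_pdivrMr// mul1r.
    by rewrite ltNge (ltW yth).
  have jM : (j < M)%N.
    rewrite -(ltr_nat R); apply: (le_lt_trans j1); rewrite ltr_pdivrMr//.
    by rewrite mulrC divfK// pnatr_eq0 -lt0n.
  (* Index [k] stands for frequency [k + 1], hence the predecessor. *)
  have kM : (j.-1 < M.-1)%N by rewrite -ltnS !prednK.
  pose k := Ordinal kM.
  have [g g1 gE] := H Nm Np M adm hd k.
  have e2 : eps <= 2^-1 by rewrite ge_min lexx.
  have e3 : eps * (`|kappa| * (1 + r)) <= zeta / 2.
    apply: (@le_trans _ _ (zeta / (2 * (`|kappa| * (1 + r))) * (`|kappa| * (1 + r)))).
      by rewrite ler_pM2r// /eps ge_min lexx orbT.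
    rewrite le_eqVlt; apply/orP; left; apply/eqP.
    by move: (_ * (1 + r)) K0 => K K0; field; rewrite gt_eqF.
  have g0 : 0 < g by move: g1; rewrite ler_norml => /andP[? ?]; lra.
  have [/andP[t0 _] f0 mE] := modeE Nm Np M k g adm g0 gE.
  apply: (@A_h_lower R L sm sp Nm Np M hL Nm0 Np0 M0 k C C0); rewrite mE /=.
  have kj : k.+1 = j by rewrite /= prednK.
  have cx := @cos_gtN1 R M M0 k.
  have := HB _ cx; have fle := rho2_le hr hry t0.
  move: (Num.sqrt _) f0 fle {mE gE} => f f0 fle gap.
  have thd : `|k.+1%:R * (pi / M%:R) - theta| <= pi / M%:R.
    rewrite kj distrC ger0_norm ?subr_ge0 -?ler_pdivlMr//.
    by move: j2; rewrite ltr_pdivrMr// -natr1 mulrDl mul1r => /ltW; lra.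
  have gap1 : `|1 + kappa * f| <= zeta / 2.
    apply: (le_trans gap); apply: le_trans (ltW yB).
    by rewrite mulrC ler_pM2r.
  have gap2 : `|kappa * f * (g - 1)| <= zeta / 2.
    apply: le_trans e3; rewrite !normrM (gtr0_norm f0) mulrC.
    by rewrite ler_pM// ?mulr_ge0 ?(ltW f0)// ler_wpM2l.
  have gap3 : `|1 + kappa * (f * g)| <= zeta.
    have -> : 1 + kappa * (f * g) = (1 + kappa * f) + kappa * f * (g - 1) by ring.
    by apply: le_trans (ler_normD _ _) _; lra.
  have rho0 : 0 < f * g by rewrite mulr_gt0.
  have zE : C * `|sm| * zeta = 1 by rewrite divff// gt_eqF// mulr_gt0.
  rewrite -[leRHS]zE mulrAC [`|sm| * C]mulrC ler_pM2l ?mulr_gt0//.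
  rewrite ler_pdivrMr ?addr_gt0//; apply: (le_trans gap3).
  by rewrite ler_peMr ?(ltW zeta0)// lerDl ltW.
Qed.
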